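(* For any semiprime algebra $A\in\mathcal{V}$ such that $K(A)$ is closed under the commutator operation, the following are equivalent: (1) $A$ is a $PP$-algebra; (2) the reticulation $L(A)$ is a Stone lattice; (3) $L(A)$ is a conormal lattice and $Min_{Id,Z}(L(A))$ is compact; (4) $A$ is an $mp$-algebra and $Min_Z(A)$ is compact; (5) $A$ is a $PF$-algebra and $Min_Z(A)$ is compact.
   Context: $\mathcal{V}$ is a fixed congruence-modular variety of algebras (of a finite signature) that is semidegenerate: no nontrivial algebra in $\mathcal{V}$ has one-element subalgebras (equivalently, $\nabla_A$ is compact in $Con(A)$ for every $A\in\mathcal{V}$). For $A\in\mathcal{V}$, $Con(A)$ is the complete lattice of congruences of $A$, with least element $\Delta_A$ and greatest element $\nabla_A$; $K(A)$ is the set of compact (= finitely generated) congruences and $PCon(A)$ the set of principal congruences. $B(Con(A))$ is the set of complemented elements of $Con(A)$. Commutator: $[\cdot,\cdot]=[\cdot,\cdot]_A$ is the (modular) commutator, i.e. the greatest operation on the congruence lattices of members of $\mathcal{V}$ such that for every surjective morphism $f:A\to B$ in $\mathcal{V}$ and all $\alpha,\beta\in Con(A)$: $[\alpha,\beta]_A\subseteq\alpha\cap\beta$ and $[\alpha,\beta]_A\vee Ker(f)=f^{-1}([f(\alpha\vee Ker(f)),f(\beta\vee Ker(f))]_B)$. Put $\alpha^{\perp}=\bigvee\{\gamma\in Con(A)\mid[\alpha,\gamma]=\Delta_A\}$. $\phi\in Con(A)\setminus\{\nabla_A\}$ is prime if $[\alpha,\beta]\subseteq\phi$ implies $\alpha\subseteq\phi$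 or $\beta\subseteq\phi$ (for $\alpha,\beta\in Con(A)$); $Spec(A)$ is the set of prime congruences; $\rho(\theta)=\bigcap\{\phi\in Spec(A)\mid\theta\subseteq\phi\}$; $A$ is semiprime if $\rho(\Delta_A)=\Delta_A$. The Zariski topology on $Spec(A)$ has open sets $D(\theta)=\{\phi\in Spec(A)\mid\theta\not\subseteq\phi\}$, $\theta\in Con(A)$; $Min_Z(A)$ is the set $Min(A)$ of minimal prime congruences with the induced topology. Reticulation: when $K(A)$ is closed under the commutator, $L(A)=K(A)/{\equiv}$ where $\alpha\equiv\beta$ iff $\rho(\alpha)=\rho(\beta)$; $\lambda_A:K(A)\to L(A)$ is the quotient map; $L(A)$ is a bounded distributive lattice with $\lambda_A(\alpha)\vee\lambda_A(\beta)=\lambda_A(\alpha\vee\beta)$, $\lambda_A(\alpha)\wedge\lambda_A(\beta)=\lambda_A([\alpha,\beta])$, $0=\lambda_A(\Delta_A)$, $1=\lambda_A(\nabla_A)$. $A$ is a $PP$-algebra if $\alpha^{\perp}\in B(Con(A))$ for every $\alpha\in PCon(A)$. $A$ is an $mp$-algebra if every prime congruence contains a unique minimal prime congruence. A congruence $\theta$ is pure if for every $\alpha\in K(A)$ with $\alpha\subseteq\theta$ one has $\theta\vee\alpha^{\perp}=\nabla_A$; $A$ is a $PF$-algebra if $\alpha^{\perp}$ is pure for all $\alpha\in PCon(A)$. For a bounded distributive lattice $L$: $B(L)$ is the set of complemented elements, $(e]=\{y\in L\mid y\leq e\}$, $Ann(x)=\{y\in L\mid x\wedge y=0\}$. $L$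 is a Stone lattice if for each $x\in L$ there is $e\in B(L)$ with $Ann(x)=(e]$. $L$ is conormal if for all $a,b\in L$ with $a\wedge b=0$ there exist $x,y\in L$ with $a\wedge x=b\wedge y=0$ and $x\vee y=1$. $Min_{Id,Z}(L)$ is the set of minimal prime ideals of $L$ with the topology induced by the Stone topology on prime ideals (basis $\{Q\mid x\notin Q\}$, $x\in L$). *)

(* Defs.v *)
From HB Require Import structures.
From mathcomp Require Import all_boot all_order.
From mathcomp Require Import generic_quotient.
From mathcomp Require Import boolp classical_sets functions cardinality topology.

Set Implicit Arguments.
Unset Strict Implicit.
Unset Printing Implicit Defensive.
Import Order.TTheory.

Local Open Scope order_scope.
Local Open Scope classical_set_scope.
Local Open Scope quotient_scope.
(* In both scopes `&` and `|` are overloaded: below, %O is the lattice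
   operation and the unannotated one is the operation on sets. *)

Record signature := Signature { symbol : finType; arity : symbol -> nat }.

Record algebra (S : signature) := Algebra {
  carrier :> Type;
  opr : forall f : symbol S, ('I_(arity f) -> carrier) -> carrier;
  carrier_inhabited : inhabited carrier }.

Inductive term (S : signature) : Type :=
  | Var of nat
  | App (f : symbol S) of ('I_(arity f) -> term S).

Fixpoint eval (S : signature) (A : algebra S) (v : nat -> A) (t : term S) : A :=
  match t with
  | Var n => v n
  | App f ts => opr (fun i => eval v (ts i))
  end.

(* A variety is presented by a set of identities (Birkhoff). *)
Definition variety (S : signature) : Type := set (term S * term S).

Definition models (S : signature) (V : variety S) (A : algebra S) : Prop :=
  forall e, V e -> forall v : nat -> A, eval v e.1 = eval v e.2.

Record alg (S : signature) (V : variety S) := Alg {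
  alg_algebra :> algebra S;
  algP : models V alg_algebra }.

Definition subuniverse (S : signature) (A : algebra S) (X : set A) : Prop :=
  forall (f : symbol S) (x : 'I_(arity f) -> A), (forall i, X (x i)) -> X (opr x).

Definition trivial_algebra (S : signature) (A : algebra S) : Prop :=
  forall x y : A, x = y.

Definition semidegenerate (S : signature) (V : variety S) : Prop :=
  forall A : alg V, ~ trivial_algebra A ->
    ~ exists a : A, subuniverse [set a].

Record epi (S : signature) (A B : algebra S) := Epi {
  epi_fun :> A -> B;
  epi_morph : forall (f : symbol S) (x : 'I_(arity f) -> A),
    epi_fun (opr x) = opr (fun i => epi_fun (x i));
  epi_surj : forall y, exists x, epi_fun x = y }.

Record Con (S : signature) (A : algebra S) := MkCon {
  con_rel :> A -> A -> Prop;
  con_refl : forall x, con_rel x x;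
  con_sym : forall x y, con_rel x y -> con_rel y x;
  con_trans : forall x y z, con_rel x y -> con_rel y z -> con_rel x z;
  con_opr : forall (f : symbol S) (x y : 'I_(arity f) -> A),
    (forall i, con_rel (x i) (y i)) -> con_rel (opr x) (opr y) }.

HB.instance Definition _ S (A : algebra S) := gen_eqMixin (Con A).
HB.instance Definition _ S (A : algebra S) := gen_choiceMixin (Con A).

Section CongruenceLattice.
Variables (S : signature) (A : algebra S).
Implicit Types (x y z : A) (a b c : Con A) (X : set (Con A)).

Lemma con_ext a b : (forall x y, a x y <-> b x y) -> a = b.
Proof.
case: a b => [r r1 r2 r3 r4] [s s1 s2 s3 s4] /= rs.
have E : r = s by apply/funext => x; apply/funext => y; apply/propext.
by subst s; congr MkCon; exact: Prop_irrelevance.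
Qed.

Definition con_le a b : bool := `[< forall x y, a x y -> b x y >].

Lemma con_le_refl : reflexive con_le. Proof. by move=> a; apply/asboolP. Qed.

Lemma con_le_anti : antisymmetric con_le.
Proof.
by move=> a b /andP[/asboolP ab /asboolP ba]; apply: con_ext => x y; split; auto.
Qed.

Lemma con_le_trans : transitive con_le.
Proof.
by move=> a b c /asboolP ab /asboolP ac; apply/asboolP => x y /ab /ac.
Qed.

HB.instance Definition _ := Order.Le_isPOrder.Build (Order.Disp tt tt) (Con A)
  con_le_refl con_le_anti con_le_trans.

Lemma con_leP a b : reflect (forall x y, a x y -> b x y) (a <= b).
Proof. exact: asboolP. Qed.

Lemma con_leW a b x y : a <= b -> a x y -> b x y.
Proof. by move=> /con_leP; apply. Qed.

Program Definition con_inf X : Con A :=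
  @MkCon S A (fun x y => forall a, X a -> a x y) _ _ _ _.
Next Obligation. by move=> X x a _; exact: con_refl. Qed.
Next Obligation. by move=> X x y h a Xa; apply: con_sym; exact: h. Qed.
Next Obligation.
by move=> X x y z h h' a Xa; apply: con_trans (h a Xa) (h' a Xa).
Qed.
Next Obligation. by move=> X f x y h a Xa; apply: con_opr => i; exact: h. Qed.

Definition con_sup X : Con A := con_inf (ubound X).

Lemma con_inf_lb X a : X a -> con_inf X <= a.
Proof. by move=> Xa; apply/con_leP => x y; apply. Qed.

Lemma con_inf_glb X a : (forall b, X b -> a <= b) -> a <= con_inf X.
Proof. by move=> h; apply/con_leP => x y axy b /h/con_leP; apply. Qed.

Lemma con_sup_ub X a : X a -> a <= con_sup X.
Proof. by move=> Xa; apply: con_inf_glb => b; apply. Qed.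

Lemma con_sup_lub X a : (forall b, X b -> b <= a) -> con_sup X <= a.
Proof. by move=> h; apply: con_inf_lb. Qed.

Definition con_meet a b := con_inf [set a; b].
Definition con_join a b := con_sup [set a; b].

Lemma con_lexI a b c : (a <= con_meet b c) = (a <= b) && (a <= c).
Proof.
apply/idP/andP => [h|[ab ac]]; last by apply: con_inf_glb => d [->|->].
by split; apply: (le_trans h); apply: con_inf_lb; [left|right].
Qed.

Lemma con_leUx a b c : (con_join a b <= c) = (a <= c) && (b <= c).
Proof.
apply/idP/andP => [h|[ab ac]]; last by apply: con_sup_lub => d [->|->].
by split; apply: le_trans h; apply: con_sup_ub; [left|right].
Qed.

HB.instance Definition _ :=
  Order.POrder_MeetJoin_isLattice.Build _ (Con A) con_lexI con_leUx.

Program Definition con_bot : Con A := @MkCon S A (fun x y => x = y) _ _ _ _.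
Next Obligation. by []. Qed.
Next Obligation. by []. Qed.
Next Obligation. by move=> x y z ->. Qed.
Next Obligation. by move=> f x y h; congr opr; apply/funext. Qed.

Program Definition con_top : Con A := @MkCon S A (fun _ _ => True) _ _ _ _.
Next Obligation. by []. Qed.
Next Obligation. by []. Qed.
Next Obligation. by []. Qed.
Next Obligation. by []. Qed.

Lemma con_le0x a : con_bot <= a.
Proof. by apply/con_leP => x _ <-; exact: con_refl. Qed.

Lemma con_lex1 a : a <= con_top. Proof. exact/con_leP. Qed.

HB.instance Definition _ := Order.hasBottom.Build _ (Con A) con_le0x.
HB.instance Definition _ := Order.hasTop.Build _ (Con A) con_lex1.

Definition Cg x y : Con A := con_inf [set a | a x y].

Definition PCon : set (Con A) := [set a | exists x y, a = Cg x y].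

Definition K : set (Con A) := [set a | forall X, a <= con_sup X ->
  exists Y, [/\ finite_set Y, Y `<=` X & a <= con_sup Y]].

End CongruenceLattice.

Definition modular_lattice (d : Order.disp_t) (L : latticeType d) : Prop :=
  forall x y z : L, x <= z -> (x `|` (y `&` z) = (x `|` y) `&` z)%O.

Definition congruence_modular (S : signature) (V : variety S) : Prop :=
  forall A : alg V, modular_lattice (Con A).

Section Commutator.
Variables (S : signature).

Section Morphism.
Variables (A B : algebra S) (f : epi A B).

Program Definition con_preim (b : Con B) : Con A :=
  @MkCon S A (fun x y => b (f x) (f y)) _ _ _ _.
Next Obligation. by move=> b x; exact: con_refl. Qed.
Next Obligation. by move=> b x y; exact: con_sym. Qed.
Next Obligation. by move=> b x y z; exact: con_trans. Qed.
Next Obligation. by move=> b g x y h /=; rewrite !epi_morph; apply: con_opr. Qed.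

Definition Ker : Con A := con_preim \bot.

(* The image f(a \/ Ker f); joining with Ker f is what makes the image of a
   congruence a congruence. *)
Program Definition con_image (a : Con A) : Con B :=
  @MkCon S B (fun u v => exists x y, [/\ f x = u, f y = v & (a `|` Ker)%O x y])
    _ _ _ _.
Next Obligation.
by move=> a x; have [y <-] := epi_surj f x; exists y, y; split=> //; exact: con_refl.
Qed.
Next Obligation.
by move=> a u v [x [y [fx fy h]]]; exists y, x; split=> //; exact: con_sym.
Qed.
Next Obligation.
move=> a u v w [x [y [fx fy h]]] [x' [y' [fx' fy' h']]]; exists x, y'.
split=> //; apply: con_trans h (con_trans _ h').
have yx' : Ker y x' by have : f y = f x' by rewrite fy fx'.
by have /con_leP := leUr Ker a; apply.
Qed.
Next Obligation.
move=> a g x y H.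
have /choice[p hp] i : exists p : A * A,
    [/\ f p.1 = x i, f p.2 = y i & (a `|` Ker)%O p.1 p.2].
  by have [s [t h]] := H i; exists (s, t).
exists (opr (fun i => (p i).1)), (opr (fun i => (p i).2)).
by rewrite !epi_morph; split;
  [congr opr; apply/funext => i|congr opr; apply/funext => i|apply: con_opr => i];
  case: (hp i).
Qed.

End Morphism.

Variable V : variety S.

Definition com_op : Type := forall A : alg V, Con A -> Con A -> Con A.

Definition admissible (C : com_op) : Prop :=
  (forall (A : alg V) (a b : Con A), C A a b <= (a `&` b)%O) /\
  (forall (A B : alg V) (f : epi A B) (a b : Con A),
     (C A a b `|` Ker f)%O = con_preim f (C B (con_image f a) (con_image f b))).

Definition commutator : com_op := fun A a b =>
  con_sup [set c | exists2 C, admissible C & c = C A a b].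

Lemma con_preim_mono (A B : algebra S) (f : epi A B) (a b : Con B) :
  a <= b -> con_preim f a <= con_preim f b.
Proof. by move=> /con_leP ab; apply/con_leP => x y /=; exact: ab. Qed.

Lemma con_imageK (A B : algebra S) (f : epi A B) (a : Con A) :
  con_preim f (con_image f a) = (a `|` Ker f)%O.
Proof.
apply: con_ext => x y; split=> [[s [t [fs ft h]]]|h]; last by exists x, y.
have k u v : f u = f v -> (a `|` Ker f)%O u v.
  by move=> fuv; have /con_leP := leUr (Ker f) a; apply.
exact: con_trans (k _ _ (esym fs)) (con_trans h (k _ _ ft)).
Qed.

Lemma con_preim_image_le (A B : algebra S) (f : epi A B) (a : Con A) (b : Con B) :
  a <= con_preim f b -> con_image f a <= b.
Proof.
move=> ab; apply/con_leP => u v [x [y [<- <- h]]].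
suff : (a `|` Ker f <= con_preim f b)%O by move=> /con_leP; apply.
by rewrite leUx ab; apply/con_preim_mono/le0x.
Qed.

Lemma admissible_bot : admissible (fun A _ _ => \bot).
Proof. by split=> [A a b|A B f a b]; rewrite ?le0x ?join0x. Qed.

Lemma commutator_greatest :
  admissible commutator /\
  forall C, admissible C -> forall (A : alg V) (a b : Con A),
    C A a b <= commutator a b.
Proof.
have ub C : admissible C -> forall (A : alg V) (a b : Con A),
    C A a b <= commutator a b.
  by move=> adC A a b; apply: con_sup_ub; exists C.
split=> //; split=> [A a b|A B f a b].
  by apply: con_sup_lub => _ [C [C1 _] ->].
apply/le_anti/andP; split.
  rewrite leUx; apply/andP; split.
    apply: con_sup_lub => _ [C adC ->].
    apply: le_trans (leUl _ (Ker f)) _; rewrite (adC.2 A B f).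
    exact/con_preim_mono/ub.
  exact/con_preim_mono/le0x.
have : commutator (con_image f a) (con_image f b)
    <= con_image f (commutator a b).
  apply: con_sup_lub => _ [C adC ->]; apply/con_leP => u v.
  have [x <-] := epi_surj f u; have [y <-] := epi_surj f v => h.
  exists x, y; split=> //.
  have : con_preim f (C B (con_image f a) (con_image f b)) x y by [].
  rewrite -(adC.2 A B f); apply/con_leP; exact: leU2 (ub _ adC _ _ _) (lexx _).
by move=> /(con_preim_mono f); rewrite con_imageK.
Qed.

End Commutator.

Section Prime.
Variables (S : signature) (V : variety S) (A : alg V).
Implicit Types a b c : Con A.

Definition K_comm_closed : Prop :=
  forall a b, K a -> K b -> K (commutator a b).

Definition perp a : Con A := con_sup [set c | commutator a c = \bot].

Definition prime_con : set (Con A) := [set p | p <> \top /\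
  forall a b, commutator a b <= p -> a <= p \/ b <= p].

Definition rho a : Con A := con_inf [set p | prime_con p /\ a <= p].

Definition semiprime : Prop := rho \bot = \bot.

Definition Spec : Type := set_type prime_con.

Definition specD a : set Spec := [set p | ~~ (a <= val p)].

Lemma SpecP (p : Spec) : prime_con (val p). Proof. exact: set_valP. Qed.

Lemma comm_leI a b : commutator a b <= (a `&` b)%O.
Proof. by have [[h _] _] := commutator_greatest V; exact: h. Qed.

Lemma prime_commE (p : Con A) a b : prime_con p ->
  (commutator a b <= p) = (a <= p) || (b <= p).
Proof.
move=> [_ pP]; apply/idP/orP => [/pP//|h]; apply: le_trans (comm_leI a b) _.
by case: h => h; [apply: le_trans (leIl _ _) h|apply: le_trans (leIr _ _) h].
Qed.

Lemma specD_comm a b : specD (commutator a b) = specD a `&` specD b.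
Proof.
apply/seteqP; split=> p; rewrite /specD /= (prime_commE _ _ (SpecP p)) negb_or.
  by move/andP.
by case=> -> ->.
Qed.

Lemma specD_sup (X : set (Con A)) :
  specD (con_sup X) = \bigcup_(a in X) specD a.
Proof.
apply/seteqP; split=> p /=; last first.
  by case=> a Xa; apply: contra => /=; apply: le_trans; exact: con_sup_ub.
move=> /negP h; apply: contrapT => h'; apply: h; apply: con_sup_lub => a Xa.
by apply: contrapT => /negP h''; apply: h'; exists a.
Qed.

Lemma specD_join a b : specD (a `|` b)%O = specD a `|` specD b.
Proof.
apply/seteqP; split=> p; rewrite /specD /= leUx negb_and; first by move/orP.
by move=> h; apply/orP.
Qed.

Lemma specD_bot : specD \bot = set0.
Proof. by apply/seteqP; split=> p //=; rewrite /specD /= le0x. Qed.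

Lemma specD_top : specD \top = setT.
Proof.
apply/seteqP; split=> p //= _; rewrite /specD /= le1x.
by apply/eqP; case: (SpecP p).
Qed.

Lemma rhoE a b : rho a = rho b <-> specD a = specD b.
Proof.
have rle c (p : Spec) : (rho c <= val p) = (c <= val p).
  apply/idP/idP => [h|h].
    by apply: le_trans h; apply: con_inf_glb => q [].
  by apply: con_inf_lb; split=> //; exact: SpecP.
split=> ab.
  by apply/funext => p; rewrite /specD /mkset -rle ab rle.
have e p (pp : prime_con p) : (a <= p) = (b <= p).
  have := congr1 (fun D : set Spec => D (SigSub (mem_set pp))) ab.
  rewrite /specD /mkset /= => E; apply: negb_inj.
  by apply/idP/idP => h; [rewrite -E|rewrite E].
by congr con_inf; apply/funext => p; apply/propext; split=> -[pp];
  [rewrite e|rewrite -e].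
Qed.

Definition zariski_open : set (set Spec) := [set U | exists a, U = specD a].

Lemma zariski_openT : zariski_open setT.
Proof. by exists \top; rewrite specD_top. Qed.

Lemma zariski_openI : setI_closed zariski_open.
Proof. by move=> _ _ [a ->] [b ->]; exists (commutator a b); rewrite specD_comm. Qed.

Lemma zariski_open_bigU (I : Type) (F : I -> set Spec) :
  (forall i, zariski_open (F i)) -> zariski_open (\bigcup_i F i).
Proof.
move=> /choice[a aP]; exists (con_sup (range a)); rewrite specD_sup bigcup_image.
by apply: eq_bigcupr => i _.
Qed.

HB.instance Definition _ := Choice.on Spec.
HB.instance Definition _ := isOpenTopological.Build Spec
  zariski_openT zariski_openI zariski_open_bigU.

Definition Min : set Spec :=
  [set p | forall q : Spec, val q <= val p -> q = p].

(* set_type carries the topology induced from Spec. *)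
Definition MinZ : topologicalType := set_type Min.

Definition pure (t : Con A) : Prop :=
  forall a, K a -> a <= t -> (t `|` perp a)%O = \top.

End Prime.

Definition complemented (d : Order.disp_t) (L : tbLatticeType d) : set L :=
  [set e | exists f : L, (e `&` f)%O = \bot /\ (e `|` f)%O = \top].

Section Lattice.
Variables (d : Order.disp_t) (L : tbDistrLatticeType d).
Implicit Types (x y a b e : L) (I P Q : set L).

Definition principal_ideal e : set L := [set y | y <= e].

Definition Ann x : set L := [set y | (x `&` y)%O = \bot].

Definition stone_lattice : Prop :=
  forall x, exists2 e, complemented e & Ann x = principal_ideal e.

Definition conormal_lattice : Prop :=
  forall a b, (a `&` b)%O = \bot -> exists x y,
    [/\ (a `&` x)%O = \bot, (b `&` y)%O = \bot & (x `|` y)%O = \top].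

Definition lattice_ideal : set (set L) := [set I |
  [/\ I \bot, forall x y, I x -> I y -> I (x `|` y)%O
    & forall x y, x <= y -> I y -> I x]].

Definition prime_ideal : set (set L) := [set P |
  [/\ lattice_ideal P, P <> setT
    & forall x y, P (x `&` y)%O -> P x \/ P y]].

Definition SpecId : Type := set_type prime_ideal.

Definition idealD x : set SpecId := [set Q | ~ val Q x].

Definition stone_open : set (set SpecId) :=
  [set U | exists X : set L, U = \bigcup_(x in X) idealD x].

Lemma SpecIdP (Q : SpecId) : prime_ideal (val Q). Proof. exact: set_valP. Qed.

Lemma idealD_meet x y : idealD (x `&` y)%O = idealD x `&` idealD y.
Proof.
apply/seteqP; split=> Q; have [[_ _ dn] _ pr] := SpecIdP Q; rewrite /idealD /=.
  by move=> h; split=> h'; apply: h; apply: dn h'; rewrite ?leIl ?leIr.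
by case=> hx hy /pr[].
Qed.

Lemma stone_openT : stone_open setT.
Proof.
exists [set \top]; rewrite bigcup_set1; apply/seteqP; split=> // Q _ Q1.
have [[_ _ dn] nT _] := SpecIdP Q; apply: nT; apply/seteqP; split=> // x _.
exact: dn (lex1 x) Q1.
Qed.

Lemma stone_openI : setI_closed stone_open.
Proof.
move=> _ _ [X ->] [Y ->].
exists [set z | exists x y, [/\ X x, Y y & z = (x `&` y)%O]].
apply/seteqP; split=> Q.
  move=> [[x Xx Qx] [y Yy Qy]]; exists (x `&` y)%O; first by exists x, y.
  by rewrite idealD_meet.
by move=> [_ [x [y [Xx Yy ->]]]]; rewrite idealD_meet => -[Qx Qy];
  split; [exists x|exists y].
Qed.

Lemma stone_open_bigU (J : Type) (F : J -> set SpecId) :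
  (forall i, stone_open (F i)) -> stone_open (\bigcup_i F i).
Proof.
move=> /choice[X XP]; exists (\bigcup_i X i).
apply/seteqP; split=> Q [].
  by move=> i _; rewrite XP => -[x Xx Qx]; exists x => //; exists i.
by move=> x [i _ Xx] Qx; exists i => //; rewrite XP; exists x.
Qed.

HB.instance Definition _ := Choice.on SpecId.
HB.instance Definition _ := isOpenTopological.Build SpecId
  stone_openT stone_openI stone_open_bigU.

Definition MinId : set SpecId :=
  [set P | forall Q : SpecId, val Q `<=` val P -> Q = P].

(* set_type carries the topology induced from SpecId. *)
Definition MinIdZ : topologicalType := set_type MinId.

End Lattice.

Section CompactCongruences.
Variables (S : signature).

Section Algebra.
Variable A : algebra S.
Implicit Types (a b : Con A) (X Y : set (Con A)).

Lemma con_supS X Y : X `<=` Y -> con_sup X <= con_sup Y.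
Proof. by move=> XY; apply: con_sup_lub => a /XY; exact: con_sup_ub. Qed.

Lemma con_sup_fin X x y : con_sup X x y ->
  exists Y, [/\ finite_set Y, Y `<=` X & con_sup Y x y].
Proof.
pose R x y := exists Y, [/\ finite_set Y, Y `<=` X & con_sup Y x y].
have Rrefl u : R u u by exists set0; split=> //; exact: con_refl.
have Rsym u v : R u v -> R v u.
  by move=> [Y [fY YX h]]; exists Y; split=> //; exact: con_sym.
have Rtrans u v w : R u v -> R v w -> R u w.
  move=> [Y [fY YX h]] [Z [fZ ZX h']]; exists (Y `|` Z); split.
  - by rewrite finite_setU.
  - by move=> c [/YX|/ZX].
  - apply: con_trans (con_leW (con_supS _) h) (con_leW (con_supS _) h');
      [exact: subsetUl|exact: subsetUr].
have Ropr (f : symbol S) (u v : 'I_(arity f) -> A) :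
    (forall i, R (u i) (v i)) -> R (opr u) (opr v).
  move=> /choice[Y YP]; exists (\bigcup_i Y i); split.
  - by apply: bigcup_finite => [|i _]; [exact: finite_finset|case: (YP i)].
  - by move=> c [i _]; have [_ h _] := YP i; exact: h.
  - apply: con_opr => i; have [_ _ h] := YP i.
    by apply: con_leW (con_supS _) h; exact: bigcup_sup.
pose r := MkCon Rrefl Rsym Rtrans Ropr.
suff /con_leP h : con_sup X <= r by exact: h.
apply: con_sup_lub => a Xa; apply/con_leP => u v auv; exists [set a]; split=> //.
- by move=> _ ->.
- by apply: con_leW (con_sup_ub _) auv.
Qed.

Lemma K_bot : K (\bot : Con A).
Proof. by move=> X _; exists set0; split=> //; exact: le0x. Qed.

Lemma K_join a b : K a -> K b -> K (a `|` b)%O.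
Proof.
move=> Ka Kb X; rewrite leUx => /andP[/Ka[Y [fY YX h]] /Kb[Z [fZ ZX h']]].
exists (Y `|` Z); split; first by rewrite finite_setU.
  by move=> c [/YX|/ZX].
rewrite leUx (le_trans h) ?(le_trans h') //; apply: con_supS;
  [exact: subsetUr|exact: subsetUl].
Qed.

End Algebra.

Section Quotient.
Variables (V : variety S) (A : alg V) (t : Con A).

Definition quo_carrier : Type := {X : set A | exists x, X = con_rel t x}.
Definition quo_pi (x : A) : quo_carrier := exist _ (con_rel t x) (ex_intro _ x erefl).
Definition quo_repr (X : quo_carrier) : A := projT1 (cid (projT2 X)).

Lemma quo_reprK X : quo_pi (quo_repr X) = X.
Proof.
case: X => X h; rewrite /quo_repr; case: cid => x /= e; rewrite /quo_pi.
by apply: eq_exist.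
Qed.

Lemma quo_piP x y : quo_pi x = quo_pi y <-> t x y.
Proof.
split=> [/(congr1 (@proj1_sig _ _)) /= ->|h]; first exact: con_refl.
apply: eq_exist; apply/funext => z; apply/propext; split.
  exact: con_trans (con_sym h).
exact: con_trans h.
Qed.

Definition quo_algebra : algebra S := @Algebra S quo_carrier
  (fun f x => quo_pi (opr (fun i => quo_repr (x i))))
  (let: inhabits x := carrier_inhabited A in inhabits (quo_pi x)).

Lemma quo_pi_opr (f : symbol S) (x : 'I_(arity f) -> A) :
  quo_pi (opr x) = @opr S quo_algebra f (fun i => quo_pi (x i)).
Proof.
apply/quo_piP; apply: con_opr => i; apply/quo_piP; by rewrite quo_reprK.
Qed.

Lemma quo_eval (v : nat -> A) (s : term S) :
  @eval S quo_algebra (fun n => quo_pi (v n)) s = quo_pi (eval v s).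
Proof.
elim: s => [//|f ts IH]; rewrite [in RHS]/= quo_pi_opr.
by rewrite -(funext IH).
Qed.

Lemma quo_models : models V quo_algebra.
Proof.
move=> e Ve v; have -> : v = fun n => quo_pi (quo_repr (v n)).
  by apply/funext => n; rewrite quo_reprK.
by rewrite !quo_eval (algP Ve).
Qed.

Definition quo : alg V := Alg quo_models.

End Quotient.

Lemma K_top (V : variety S) (A : alg V) : semidegenerate V -> K (\top : Con A).
Proof.
move=> sd X hX; have [o] := carrier_inhabited A.
have /choice[Y YP] (f : symbol S) : exists Y,
    [/\ finite_set Y, Y `<=` X & con_sup Y (opr (fun _ : 'I_(arity f) => o)) o].
  by apply: con_sup_fin; exact: con_leW hX _.
exists (\bigcup_f Y f); split.
- by apply: bigcup_finite => [|i _]; [exact: finite_finset|case: (YP i)].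
- by move=> c [i _]; have [_ h _] := YP i; exact: h.
set t := con_sup _.
have : trivial_algebra (quo t).
  apply: contrapT => /(sd (quo t)); apply; exists (quo_pi t o) => f x xo.
  have -> : x = fun=> quo_pi t o by apply/funext => i; exact: xo.
  apply: etrans (esym (quo_pi_opr t (fun=> o))) _; apply/quo_piP.
  have [_ _ h] := YP f.
  by apply: con_leW (con_supS _) h; exact: bigcup_sup.
by move=> tr; apply/con_leP => x y _; apply/quo_piP; exact: tr.
Qed.

End CompactCongruences.

Definition Kcon (S : signature) (A : algebra S) : Type := set_type (@K S A).
HB.instance Definition _ (S : signature) (A : algebra S) := Choice.on (Kcon A).

Section RhoEquivalence.
Variables (S : signature) (V : variety S) (A : alg V).

Definition rho_equiv (a b : Kcon A) : bool := rho (val a) == rho (val b).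

Lemma rho_equiv_refl : reflexive rho_equiv.
Proof. by move=> a; exact: eqxx. Qed.

Lemma rho_equiv_sym : symmetric rho_equiv.
Proof. by move=> a b; exact: eq_sym. Qed.

Lemma rho_equiv_trans : transitive rho_equiv.
Proof. by move=> b a c; rewrite /rho_equiv => /eqP->. Qed.

Canonical rho_equiv_rel :=
  EquivRel rho_equiv rho_equiv_refl rho_equiv_sym rho_equiv_trans.

End RhoEquivalence.

(* The hypotheses are not needed to form the quotient K(A)/~, only for its
   lattice operations; they are parameters of the type so that the lattice
   structure can be inferred from it. *)
Definition reticulation (S : signature) (V : variety S) (A : alg V)
    (sdV : semidegenerate V) (KA : K_comm_closed A) : Type :=
  {eq_quot (rho_equiv_rel A)}.

Section Reticulation.
Variables (S : signature) (V : variety S) (A : alg V).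
Variables (sdV : semidegenerate V) (KA : K_comm_closed A).

Local Notation L := (reticulation sdV KA).
Implicit Types (a b : Kcon A) (x y z : L).

HB.instance Definition _ := Choice.copy L {eq_quot (rho_equiv_rel A)}.

Definition lambda a : L := \pi_{eq_quot (rho_equiv_rel A)} a.

Definition lambda_repr x : Kcon A := repr (x : {eq_quot (rho_equiv_rel A)}).

Definition mkK (c : Con A) (Kc : K c) : Kcon A := SigSub (mem_set Kc).

Lemma KconP a : K (val a). Proof. exact: set_valP. Qed.

Definition Kcomm a b : Kcon A := mkK (KA (@KconP a) (@KconP b)).
Definition Kjoin a b : Kcon A := mkK (K_join (@KconP a) (@KconP b)).
Definition Kbot : Kcon A := mkK (@K_bot S A).
Definition Ktop : Kcon A := mkK (@K_top S V A sdV).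

Definition ret_meet x y : L := lambda (Kcomm (lambda_repr x) (lambda_repr y)).
Definition ret_join x y : L := lambda (Kjoin (lambda_repr x) (lambda_repr y)).

Lemma lambda_surj x : lambda (lambda_repr x) = x.
Proof. exact: reprK. Qed.

Lemma lambdaE a b : lambda a = lambda b <-> rho (val a) = rho (val b).
Proof.
split; first by move=> h; have /eqmodP/eqP := h.
by move=> h; have /eqmodP : rho_equiv_rel A a b by apply/eqP.
Qed.

Let D x : set (Spec A) := specD (val (lambda_repr x)).

Let D_lambda a : D (lambda a) = specD (val a).
Proof. by apply/rhoE/lambdaE; rewrite lambda_surj. Qed.

Let D_inj : injective D.
Proof.
by move=> x y /rhoE/lambdaE; rewrite !lambda_surj.
Qed.

Let D_meet x y : D (ret_meet x y) = D x `&` D y.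
Proof. by rewrite D_lambda specD_comm. Qed.

Let D_join x y : D (ret_join x y) = D x `|` D y.
Proof. by rewrite D_lambda specD_join. Qed.

Definition ret_le x y : bool := ret_meet x y == x.
Definition ret_lt x y : bool := (y != x) && ret_le x y.

Lemma ret_meetC : commutative ret_meet.
Proof. by move=> x y; apply: D_inj; rewrite !D_meet setIC. Qed.

Lemma ret_joinC : commutative ret_join.
Proof. by move=> x y; apply: D_inj; rewrite !D_join setUC. Qed.

Lemma ret_meetA : associative ret_meet.
Proof. by move=> x y z; apply: D_inj; rewrite !D_meet setIA. Qed.

Lemma ret_joinA : associative ret_join.
Proof. by move=> x y z; apply: D_inj; rewrite !D_join setUA. Qed.

Lemma ret_joinKI y x : ret_meet x (ret_join x y) = x.
Proof. by apply: D_inj; rewrite D_meet D_join setUC setKU. Qed.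

Lemma ret_meetKU y x : ret_join x (ret_meet x y) = x.
Proof. by apply: D_inj; rewrite D_join D_meet setIC setKI. Qed.

Lemma ret_meetUl : left_distributive ret_meet ret_join.
Proof. by move=> x y z; apply: D_inj; rewrite !(D_meet, D_join) setIUl. Qed.

Lemma ret_meetxx : idempotent_op ret_meet.
Proof. by move=> x; apply: D_inj; rewrite D_meet setIid. Qed.

HB.instance Definition _ :=
  Order.isMeetJoinDistrLattice.Build (Order.Disp tt tt) L
    (fun _ _ => erefl) (fun _ _ => erefl) ret_meetC ret_joinC ret_meetA ret_joinA
    ret_joinKI ret_meetKU ret_meetUl ret_meetxx.

Lemma ret_le0x x : lambda Kbot <= x.
Proof.
by apply/eqP/D_inj; rewrite D_meet D_lambda specD_bot set0I.
Qed.

Lemma ret_lex1 x : x <= lambda Ktop.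
Proof.
by apply/eqP/D_inj; rewrite D_meet D_lambda specD_top setIT.
Qed.

HB.instance Definition _ := Order.hasBottom.Build _ L ret_le0x.
HB.instance Definition _ := Order.hasTop.Build _ L ret_lex1.

Lemma lambda_meet a b : (lambda a `&` lambda b)%O = lambda (Kcomm a b).
Proof. by apply: D_inj; rewrite D_meet !D_lambda specD_comm. Qed.

Lemma lambda_join a b : (lambda a `|` lambda b)%O = lambda (Kjoin a b).
Proof. by apply: D_inj; rewrite D_join !D_lambda specD_join. Qed.

Lemma lambda_bot : lambda Kbot = \bot. Proof. by []. Qed.

Lemma lambda_top : lambda Ktop = \top. Proof. by []. Qed.

End Reticulation.

Section AlgebraClasses.
Variables (S : signature) (V : variety S) (A : alg V).

Definition PP_algebra : Prop :=
  forall a : Con A, PCon a -> complemented (perp a).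

Definition PF_algebra : Prop :=
  forall a : Con A, PCon a -> pure (perp a).

Definition mp_algebra : Prop :=
  forall p : Spec A, exists! q : Spec A, Min q /\ val q <= val p.

End AlgebraClasses.

(* Main.v *)
Require Import Defs.
From mathcomp Require Import all_boot all_order.
From mathcomp Require Import boolp classical_sets cardinality topology.

Set Implicit Arguments.
Unset Strict Implicit.
Unset Printing Implicit Defensive.
Import Order.TTheory.

Local Open Scope order_scope.
Local Open Scope classical_set_scope.

(** The five conditions compare the congruences [perp a], the reticulation
    [L(A)] and the spaces of minimal primes.  The proof is a cycle, and it rests
    on two facts about the commutator, from which everything else is spectral.

    - The commutator is monotone ([commutator_mono]), and every proper
      congruence lies below a prime one ([proper_below_prime]).  For the second
      fact it is enough that [commutator \top \top = \top], since then the
      commutator of two congruences that are not below a maximal congruence [m]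
      is not below [m], as one sees in the simple quotient by [m].
    - Both facts are obtained from the maximality of the commutator among the
      admissible operations, by exhibiting admissible operations that have the
      wanted property.  Closing an admissible operation under monotonicity
      keeps it admissible by the modular law.  For the value at the top, the
      operation is [centrality_commutator a b], the least [d] such that [a]
      centralizes [b] modulo [d]: some congruence on the subalgebra [b] of
      [A * A] relates the diagonal elements [(x, x)] and [(y, y)] when [a x y],
      and relates [(x, x)] to [(x, y)] only when [d x y].  If [\top] centralizes
      [\top] modulo [d], the diagonal collapses to a one-element subalgebra of
      a quotient of [A * A]; semidegeneracy makes that quotient trivial, so
      [d = \top].  Admissibility is the hard part: centrality must survive the
      enlargement of [d] ([central_strong]) and must be symmetric
      ([central_sym]); both come from the modular law on subalgebras of powers
      of [A], the second through the shifting lemma on triples.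

    When [A] is semiprime, [commutator a b = \bot] says that no prime congruence
    omits both [a] and [b]; so [perp a] is the largest congruence with this
    property with respect to [a] ([perpP]).  Monotonicity makes prime
    congruences correspond to prime ideals of [L(A)] by an order isomorphism
    ([ideal_of_specK], [spec_of_idealK], [ideal_of_spec_le]), which maps the
    minimal prime ideals continuously onto the minimal prime congruences
    ([MinZ_compact]).  Facts about primes are proved in the lattice: a maximal
    proper filter is the complement of a minimal prime ideal
    ([minimal_prime_avoiding]), so if the annihilator of [x] is contained in a
    prime, some minimal prime below it omits [x] ([minimal_prime_below]).

    The cycle is then as follows.  If [perp a] is complemented for principal
    [a], compactness of [\top] replaces the complemented pair by a pair of
    compact congruences, that is by a complemented element of [L(A)]
    ([clopen_complemented]), which generates the annihilator of [a]; finite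
    joins give the other elements of [L(A)] ([PP_stone]).  A Stone lattice is
    conormal, and pseudocomplements make its minimal prime spectrum compact
    ([pseudocomplemented_MinId_compact]).  Conormality separates two minimal
    primes, so that no prime contains both ([conormal_mp]).  If a prime
    contained [perp a] and [perp c] with [c <= perp a], its unique minimal prime
    would omit both [a] and [c], which is impossible; hence [perp a] is pure
    ([mp_PF]).  Finally, compactness of the space of minimal primes provides a
    compact [l <= perp a] such that no minimal prime contains [a] and [l]; then
    [perp l] meets [perp a] in [\bot], and purity makes their join [\top]
    ([PF_PP]). *)

(** * Congruences and homomorphisms *)

Section Pullback.
Variables (S : signature) (A B : algebra S).

Definition is_hom (h : A -> B) : Prop :=
  forall (f : symbol S) (x : 'I_(arity f) -> A),
    h (opr x) = opr (fun i => h (x i)).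

Program Definition con_pull (h : A -> B) (hh : is_hom h) (b : Con B) : Con A :=
  @MkCon S A (fun x y => b (h x) (h y)) _ _ _ _.
Next Obligation. by move=> h _ b x; exact: con_refl. Qed.
Next Obligation. by move=> h _ b x y; exact: con_sym. Qed.
Next Obligation. by move=> h _ b x y z; exact: con_trans. Qed.
Next Obligation. by move=> h hh b f x y H /=; rewrite !hh; exact: con_opr. Qed.

End Pullback.

Section Congruences.
Variables (S : signature) (A : algebra S).
Implicit Types a b c d : Con A.

Lemma con_meetP a b x y : (a `&` b)%O x y <-> a x y /\ b x y.
Proof.
split=> [h|[ax bx]].
  by split; [apply: con_leW h; exact: leIl|apply: con_leW h; exact: leIr].
by move=> c [->|->].
Qed.

Lemma con_joinl a b x y : a x y -> (a `|` b)%O x y.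
Proof. by apply: con_leW; exact: leUl. Qed.

Lemma con_joinr a b x y : b x y -> (a `|` b)%O x y.
Proof. by apply: con_leW; exact: leUr. Qed.

Lemma Cg_le a x y : (Cg x y <= a) <-> a x y.
Proof.
split=> [/con_leP|axy]; last exact: con_inf_lb.
by apply=> c.
Qed.

(** The rectangle [x, y, v, u] has horizontal sides in [a] and vertical sides
    in [b]; its bottom side lies in [a `&` c], and going around the other three
    sides puts [(x, y)] in [((a `&` c) `|` b) `&` a], which the modular law turns
    into [(a `&` c) `|` (b `&` a)]. *)
Lemma shifting (m : modular_lattice (Con A)) a b c x y u v :
  (a `&` b <= c)%O -> a x y -> a u v -> b x u -> b y v -> c u v -> c x y.
Proof.
move=> abc axy auv bxu byv cuv.
have xy : ((a `&` c) `|` b)%O x y.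
  apply: (con_trans (con_joinr bxu)).
  apply: (con_trans _ (con_joinr (con_sym byv))).
  exact/con_joinl/con_meetP.
have {xy} : (((a `&` c) `|` b) `&` a)%O x y by exact/con_meetP.
rewrite -m ?leIl //; apply: con_leW.
by rewrite leUx leIr meetC.
Qed.

End Congruences.

(** * Subalgebras of powers *)

Section BlockPower.
Variables (S : signature) (V : variety S) (A : alg V) (I : Type) (b : Con A).

(** Tuples with pairwise [b]-related entries, a subalgebra of the power of [A].
    For [I = bool] this is the congruence [b] itself, seen as a subalgebra of
    [A * A]; three-element tuples are needed for the symmetry of centrality. *)
Definition bpow_carrier : Type := {u : I -> A | forall i j, b (u i) (u j)}.

Program Definition bpow_opr (f : symbol S) (x : 'I_(arity f) -> bpow_carrier) :
  bpow_carrier := exist _ (fun i => opr (fun k => sval (x k) i)) _.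
Next Obligation. by move=> f x i j; apply: con_opr => k; exact: (svalP (x k)). Qed.

Lemma bpow_inhabited : inhabited bpow_carrier.
Proof.
case: (carrier_inhabited A) => x; apply: inhabits.
by exists (fun _ => x) => i j; exact: con_refl.
Qed.

Definition bpow_algebra : algebra S := Algebra bpow_opr bpow_inhabited.

Lemma bpow_ext (u v : bpow_carrier) : (forall i, sval u i = sval v i) -> u = v.
Proof.
case: u v => [u hu] [v hv] /= /funext uv; subst v.
by congr exist; exact: Prop_irrelevance.
Qed.

Lemma bpow_eval (v : nat -> bpow_algebra) (t : term S) (i : I) :
  sval (Defs.eval v t) i = Defs.eval (fun n => sval (v n) i) t.
Proof. by elim: t => [//|f ts IH] /=; congr opr; apply/funext => k; exact: IH. Qed.

Lemma bpow_models : models V bpow_algebra.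
Proof. by move=> e Ve v; apply: bpow_ext => i; rewrite !bpow_eval (algP Ve). Qed.

Definition bpow : alg V := Alg bpow_models.

Program Definition bdiag (x : A) : bpow := exist _ (fun _ => x) _.
Next Obligation. by move=> x i j; exact: con_refl. Qed.

Definition coord (i : I) (u : bpow) : A := sval u i.

Lemma coord_hom i : is_hom (coord i). Proof. by []. Qed.

Definition at_coord (i : I) (c : Con A) : Con bpow := con_pull (coord_hom i) c.

Lemma bdiag_hom : is_hom bdiag.
Proof. by move=> f x; exact: bpow_ext. Qed.

End BlockPower.
Arguments bpow {S V A} I b.
Arguments bdiag {S V A} I b x.
Arguments at_coord {S V A I b} i c.

Section Reindex.
Variables (S : signature) (V : variety S) (A : alg V) (I J : Type) (b : Con A).

Program Definition reindex (s : J -> I) (u : bpow I b) : bpow J b :=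
  exist _ (fun j => sval u (s j)) _.
Next Obligation. by move=> s u i j /=; exact: (svalP u). Qed.

Lemma reindex_hom s : is_hom (reindex s).
Proof. by move=> f x; exact: bpow_ext. Qed.

End Reindex.

Section BlockMap.
Variables (S : signature) (V : variety S) (A B : alg V) (I : Type).
Variables (h : A -> B) (hh : is_hom h) (b : Con A) (c : Con B).
Hypothesis bc : forall x y, b x y -> c (h x) (h y).

Program Definition bmap (u : bpow I b) : bpow I c :=
  exist _ (fun i => h (sval u i)) _.
Next Obligation. by move=> u i j /=; apply: bc; exact: (svalP u). Qed.

Lemma bmap_hom : is_hom bmap.
Proof. by move=> f x; apply: bpow_ext => i /=; exact: hh. Qed.

End BlockMap.

Section Pairs.
Variables (S : signature) (V : variety S) (A : alg V) (b : Con A).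

Program Definition bpair (x y : A) (h : b x y) : bpow bool b :=
  exist _ (fun i => if i then y else x) _.
Next Obligation.
by move=> x y h [] [] /=; [exact: con_refl|exact: con_sym| |exact: con_refl].
Qed.

Lemma bpair_irr x y (h h' : b x y) : bpair h = bpair h'.
Proof. exact: bpow_ext. Qed.

Lemma bpair_diag x (h : b x x) : bpair h = bdiag bool b x.
Proof. by apply: bpow_ext => -[]. Qed.

Lemma bpair_eta (u : bpow bool b) :
  exists x y (h : b x y), u = bpair h.
Proof.
exists (sval u false), (sval u true), (svalP u false true).
by apply: bpow_ext => -[].
Qed.

End Pairs.

(** * Centrality modulo a congruence *)

Section Centrality.
Variables (S : signature) (V : variety S) (hmod : congruence_modular V).
Variables (A : alg V).
Implicit Types a b c d e : Con A.

(** The restriction of [d * d] to the subalgebra [b]. *)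
Definition both_coords b d : Con (bpow bool b) :=
  (at_coord false d `&` at_coord true d)%O.

(** The pairs [(x, x)] and [(y, y)] with [a x y] generate the congruence of
    Hagemann and Herrmann on the subalgebra [b]; a witness is any congruence
    above it in which [(x, x)] and [(x, y)] are related only modulo [d]. *)
Definition central_witness a b d (Psi : Con (bpow bool b)) : Prop :=
  (forall x y, a x y -> Psi (bdiag bool b x) (bdiag bool b y)) /\
  (forall x y (h : b x y), Psi (bdiag bool b x) (bpair h) -> d x y).

Definition centralizes a b d : Prop := exists Psi, @central_witness a b d Psi.

Lemma both_coordsP b d (u v : bpow bool b) :
  both_coords b d u v <->
  d (sval u false) (sval v false) /\ d (sval u true) (sval v true).
Proof. exact: con_meetP. Qed.

(** The condition on [(x, x)] and [(x, y)] extends to all pairs [(z, x)] and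
    [(z, y)]: the rectangle with these four corners has its vertical sides in
    the kernel of the second projection, so the shifting lemma applies. *)
Lemma central_slide a b d Psi : @central_witness a b d Psi ->
  (Psi `&` at_coord false \bot <= at_coord true d)%O.
Proof.
move=> [_ Pd]; apply/con_leP => u v /con_meetP[Puv uv].
have [z [x [zx Eu]]] := bpair_eta u; have [z' [y [zy Ev]]] := bpair_eta v.
subst u v; have {}uv : z = z' := uv; subst z'.
have xy : b x y := con_trans (con_sym zx) zy.
suff : Psi (bdiag bool b x) (bpair xy) by exact: Pd.
have m : modular_lattice (Con (bpow bool b)) by exact: hmod.
apply: (shifting m (a := at_coord false \bot)
  (b := at_coord true \bot) (c := Psi) (u := bpair zx) (v := bpair zy)) => //.
apply/con_leP => s t /con_meetP[st st'].
suff -> : s = t by exact: con_refl.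
by apply: bpow_ext => -[].
Qed.

(** The new witness is [D `|` (e * e)], where [D] is the old one, cut down to
    pairs that are componentwise [a]-related.  Writing [e0] for the kernel of
    the first projection, the condition to check is
    [(D `|` (e * e)) `&` e0 <= e] on second components.  The modular law reduces
    [e * e] to its part below [D `|` e0]; there, moving first components along
    the diagonal shows that it is generated by [D] and by pairs with equal
    first components, and a last use of the modular law leaves only
    [D `&` e0], which [central_slide] controls. *)
Lemma central_strong a b d e : d <= e -> centralizes a b d ->
  exists2 Psi, @central_witness a b e Psi & both_coords b e <= Psi.
Proof.
move=> de [D0 [D0a D0d]].
have modb : modular_lattice (Con (bpow bool b)) by exact: hmod.
pose D := (D0 `&` both_coords b a)%O.
have Da x y : a x y -> D (bdiag bool b x) (bdiag bool b y).
  by move=> axy; apply/con_meetP; split; [exact: D0a|exact/both_coordsP].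
have wD : @central_witness a b d D.
  by split=> // x y h /con_meetP[/D0d].
exists (D `|` both_coords b e)%O; last exact: leUr.
split=> [x y axy|x y h Pxy]; first exact/con_joinl/Da.
pose e0 : Con (bpow bool b) := at_coord false \bot.
pose t := (D `&` both_coords b e)%O; pose d1 := (e0 `&` at_coord true e)%O.
(* On pairs with [a]-related first components, [(x, y)] can be moved to
   [(x, x)] inside [e0], and then along the diagonal inside [D]. *)
have tame : (both_coords b e `&` (D `|` e0) <= t `|` d1)%O.
  apply/con_leP => u v /con_meetP[/both_coordsP[euv euv'] Duv].
  have {Duv} auv : a (sval u false) (sval v false).
    have : (D `|` e0 <= at_coord false a)%O.
      rewrite leUx; apply/andP; split.
        by apply: le_trans (leIr _ _) _; exact: leIl.
      by apply/con_leP => s r /= ->; exact: con_refl.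
    by move=> /con_leW/(_ Duv).
  rewrite modb; last by apply: le_trans (leIr _ _) _; exact: leIr.
  apply/con_meetP; split=> //.
  apply: (con_trans (y := bdiag bool b (sval u false))); first exact: con_joinr.
  apply: (con_trans (y := bdiag bool b (sval v false))); last exact: con_joinr.
  by apply/con_joinl/con_meetP; split; [exact: Da|exact/both_coordsP].
suff : ((D `|` both_coords b e) `&` e0 <= at_coord true e)%O.
  move=> main; apply: (con_leW main (x := bdiag bool b x) (y := bpair h)).
  exact/con_meetP.
have dD : d1 <= e0 by exact: leIl.
have step : ((D `|` both_coords b e) `&` e0 <= (d1 `|` D) `&` e0)%O.
  rewrite lexI leIr andbT.
  have le1 : ((D `|` both_coords b e) `&` e0 <=
      (D `|` both_coords b e) `&` (D `|` e0))%O.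
    by apply: leI2 => //; exact: leUr.
  apply: le_trans le1 _; rewrite -modb ?leUl // leUx leUr /=.
  by apply: le_trans tame _; rewrite joinC; apply: leU2; rewrite ?leIl.
apply: le_trans step _; rewrite -modb // leUx leIr /=.
by apply: le_trans (central_slide wD) _; apply/con_leP => u v; exact: (con_leW de).
Qed.

Lemma central_upward a b d e : d <= e -> centralizes a b d -> centralizes a b e.
Proof. by move=> de /(central_strong de)[Psi w _]; exists Psi. Qed.

Lemma central_joinl a b d : centralizes a b d -> centralizes (a `|` d)%O b d.
Proof.
move=> /(central_strong (lexx d))[Psi [Pa Pd] dPsi]; exists Psi; split=> //.
suff : (a `|` d <= con_pull (@bdiag_hom _ _ _ bool b) Psi)%O.
  by move=> h x y /(con_leW h).
rewrite leUx; apply/andP; split; apply/con_leP => x y xy; first exact: Pa.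
by apply: (con_leW dPsi); apply/both_coordsP.
Qed.

Lemma central_meet a b : centralizes a b (a `&` b)%O.
Proof.
exists (both_coords b a); split=> [x y axy|x y h /both_coordsP[_ axy]].
  exact/both_coordsP.
exact/con_meetP.
Qed.

Lemma central_inf a b (X : set (Con A)) :
  (forall d, X d -> centralizes a b d) -> centralizes a b (con_inf X).
Proof.
move=> cX.
exists (con_inf [set Psi | exists2 d, X d & @central_witness a b d Psi]).
split=> [x y axy Psi [d Xd [Pa _]]|x y h Pxy d Xd]; first exact: Pa.
by have [Psi w] := cX d Xd; apply: (w.2 _ _ h); apply: Pxy; exists d.
Qed.

Inductive three := T0 | T1 | T2.

Definition side (i j : three) : bool -> three := fun k => if k then j else i.

Definition triple (x y z : A) (i : three) : A :=
  match i with T0 => x | T1 => y | T2 => z end.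

Lemma triple_block b x y z (xy : b x y) (yz : b y z) i j :
  b (triple x y z i) (triple x y z j).
Proof.
have xz := con_trans xy yz.
by case: i; case: j => /=; solve [exact: con_refl | assumption | exact: con_sym].
Qed.

Definition btriple b x y z (xy : b x y) (yz : b y z) : bpow three b :=
  exist _ (triple x y z) (triple_block xy yz).

(** Consider the triples [(x, y, z)] and [(x, y, y)] together with their primed
    versions: they agree on the first two entries, and the relation at entries
    1 and 2 is trivial on the second triple.  The shifting lemma transports it
    to the first triple.  Its side condition holds because two triples with
    equal entries 0 and 1 that are related at entries 0 and 2 have [d]-related
    last entries, by [central_slide]. *)
Lemma central_euclid a b d Psi :
  @central_witness a b d Psi -> both_coords b d <= Psi ->
  forall x y z x' y' z' (xy : b x y) (xz : b x z) (yz : b y z)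
    (xy' : b x' y') (xz' : b x' z') (yz' : b y' z'), a y y' ->
  Psi (bpair xy) (bpair xy') -> Psi (bpair xz) (bpair xz') ->
  Psi (bpair yz) (bpair yz').
Proof.
move=> w dPsi x y z x' y' z' xy xz yz xy' xz' yz' ayy' Pxy Pxz.
pose P i j : Con (bpow three b) := con_pull (reindex_hom (side i j)) Psi.
pose e i : Con (bpow three b) := at_coord i \bot.
have PE i j s t (h : b (sval s i) (sval s j)) (h' : b (sval t i) (sval t j)) :
    P i j s t <-> Psi (bpair h) (bpair h').
  have E r (k : b (sval r i) (sval r j)) : reindex (side i j) r = bpair k.
    by apply: bpow_ext => -[].
  by rewrite /P /= -!E.
have m : modular_lattice (Con (bpow three b)) by exact: hmod.
suff /PE : P T1 T2 (btriple xy yz) (btriple xy' yz') by apply.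
apply: (shifting m (a := (P T0 T1 `&` P T0 T2)%O) (b := (e T0 `&` e T1)%O)
  (u := btriple xy (con_refl b y)) (v := btriple xy' (con_refl b y'))).
- apply/con_leP => s t /con_meetP[/con_meetP[_ P02] /con_meetP[e0 e1]].
  apply: (con_leW dPsi); apply/both_coordsP; split=> /=.
    by rewrite [sval s T1]e1; exact: con_refl.
  have := con_leW (central_slide w) (x := reindex (side T0 T2) s)
    (y := reindex (side T0 T2) t); apply.
  exact/con_meetP.
- by apply/con_meetP; split; apply/PE.
- by apply/con_meetP; split; apply/PE.
- exact/con_meetP.
- exact/con_meetP.
- have E r s (h : b r s) :
      reindex (side T1 T2) (btriple h (con_refl b s)) = bdiag bool b s.
    by apply: bpow_ext => -[].
  by rewrite /P /= !E; exact: w.1.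
Qed.

(** The witness for the exchanged roles is the transpose of [Psi]: it relates
    [u] to [v] when the pair of first entries is [Psi]-related to the pair of
    second entries.  Transitivity of the transpose is not formal; it follows
    from [central_euclid]. *)
Lemma central_sym a b d : centralizes a b d -> centralizes b a d.
Proof.
move=> /(central_strong (lexx d))[Psi w dPsi].
pose T (u v : bpow bool a) := exists (h : b (sval u false) (sval v false))
  (h' : b (sval u true) (sval v true)), Psi (bpair h) (bpair h').
have Trefl u : T u u.
  exists (con_refl b _), (con_refl b _); rewrite !bpair_diag.
  by apply: w.1; exact: (svalP u).
have Teuclid u v r : T u v -> T u r -> T v r.
  move=> [h [h' P]] [k [k' Q]].
  exists (con_trans (con_sym h) k), (con_trans (con_sym h') k').
  by apply: (central_euclid w dPsi) P Q; exact: (svalP v).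
have Tsym u v : T u v -> T v u by move=> uv; exact: Teuclid uv (Trefl u).
have Ttrans u v r : T u v -> T v r -> T u r by move=> /Tsym; exact: Teuclid.
have Topr (f : symbol S) (u v : 'I_(arity f) -> bpow bool a) :
    (forall i, T (u i) (v i)) -> T (opr u) (opr v).
  move=> uv; have h i : b (sval (u i) false) (sval (v i) false) by case: (uv i).
  have h' i : b (sval (u i) true) (sval (v i) true) by case: (uv i) => k [].
  exists (con_opr h), (con_opr h').
  have -> : bpair (con_opr h) = opr (fun i => bpair (h i)).
    by apply: bpow_ext => -[].
  have -> : bpair (con_opr h') = opr (fun i => bpair (h' i)).
    by apply: bpow_ext => -[].
  apply: con_opr => i; have [k [k' P]] := uv i.
  by rewrite (bpair_irr (h i) k) (bpair_irr (h' i) k').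
exists (MkCon Trefl Tsym Ttrans Topr); split=> [x y bxy|x y axy [h [h']]] /=.
  by exists bxy, bxy; exact: con_refl.
by rewrite bpair_diag; exact: w.2.
Qed.

Lemma central_join a b d : centralizes a b d ->
  centralizes (a `|` d)%O (b `|` d)%O d.
Proof. by move=> /central_joinl/central_sym/central_joinl/central_sym. Qed.

(** Modulo the witness, the diagonal of [A * A] is a one-element subalgebra, so
    semidegeneracy makes the quotient trivial. *)
Lemma central_top (hsd : semidegenerate V) d :
  centralizes (\top : Con A) (\top : Con A) d -> d = \top.
Proof.
move=> [Psi [Pa Pd]]; have [o] := carrier_inhabited A.
pose D x : bpow bool (\top : Con A) := bdiag bool (\top : Con A) x.
have tr : trivial_algebra (quo Psi).
  apply: contrapT => /(hsd (quo Psi)); apply; exists (quo_pi Psi (D o)) => f x xo.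
  have -> : x = fun=> quo_pi Psi (D o) by apply/funext => i; exact: xo.
  apply: etrans (esym (quo_pi_opr Psi (fun=> D o))) _; apply/quo_piP.
  by rewrite -bdiag_hom; exact: Pa.
apply/le_anti; rewrite lex1 /=; apply/con_leP => x y _.
have h : (\top : Con A) x y by [].
by apply: (Pd _ _ h); apply/quo_piP; exact: tr.
Qed.

End Centrality.

(** * The commutator of a semidegenerate congruence-modular variety *)

Section CentralityAndQuotients.
Variables (S : signature) (V : variety S) (hmod : congruence_modular V).
Variables (A B : alg V) (f : epi A B).

Lemma Ker_le_preim (c : Con B) : Ker f <= con_preim f c.
Proof. exact/con_preim_mono/le0x. Qed.

Lemma con_imageP (a : Con A) x y :
  con_image f a (f x) (f y) <-> (a `|` Ker f)%O x y.
Proof. by rewrite -con_imageK. Qed.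

Lemma con_image_le (a : Con A) (c : Con B) :
  (con_image f a <= c) = (a <= con_preim f c).
Proof.
apply/idP/idP => [|h]; last exact: con_preim_image_le.
move=> /(con_preim_mono f); rewrite con_imageK; apply: le_trans; exact: leUl.
Qed.

Lemma con_preimK (c : Con B) : con_image f (con_preim f c) = c.
Proof.
apply: con_ext => u v; have [x <-] := epi_surj f u; have [y <-] := epi_surj f v.
by rewrite con_imageP (join_l (Ker_le_preim c)).
Qed.

Lemma central_preim a b (c : Con B) :
  centralizes (con_image f a) (con_image f b) c ->
  centralizes a b (con_preim f c).
Proof.
move=> [Psi [Pa Pd]].
have bc x y : b x y -> con_image f b (f x) (f y).
  by move=> bxy; apply/con_imageP/con_joinl.
exists (con_pull (bmap_hom (I := bool) (epi_morph f) bc) Psi).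
have E x : bmap bc (bdiag bool b x) = bdiag bool _ (f x) by exact: bpow_ext.
split=> [x y axy|x y h] /=.
  by rewrite !E; apply/Pa/con_imageP/con_joinl.
rewrite E; suff -> : bmap bc (bpair h) = bpair (bc _ _ h) by exact: Pd.
by apply: bpow_ext => -[].
Qed.

(** Both congruences are first enlarged by [d], so that the square of the
    kernel of [f] lies below the witness; the witness then descends along the
    surjection from the preimage subalgebra onto the image subalgebra. *)
Lemma central_image a b d : Ker f <= d -> centralizes a b d ->
  centralizes (con_image f a) (con_image f b) (con_image f d).
Proof.
move=> kd /(central_join hmod)/(central_strong hmod (lexx d))[Psi [Pa Pd] dPsi].
pose b' := con_preim f (con_image f b).
have kle a' : (a' `|` Ker f <= a' `|` d)%O by exact: leU2.
have bb x y : b' x y -> (b `|` d)%O x y.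
  by rewrite /b' con_imageK; exact: con_leW.
have b'c x y : b' x y -> con_image f b (f x) (f y) by [].
have id_hom : is_hom (fun x : A => x) by [].
pose Psi' : Con (bpow bool b') := con_pull (bmap_hom (I := bool) id_hom bb) Psi.
have surj v : exists u, bmap (I := bool) b'c u = v.
  have [x [y [xy ->]]] := bpair_eta v.
  have [s sx] := epi_surj f x; have [t ty] := epi_surj f y; subst x y.
  by exists (bpair (xy : b' s t)); apply: bpow_ext => -[].
pose g : epi (bpow bool b') (bpow bool (con_image f b)) :=
  Epi (bmap_hom (I := bool) (epi_morph f) b'c) surj.
have kg : Ker g <= Psi'.
  apply/con_leP => u v /(congr1 (@sval _ _)) uv; apply: (con_leW dPsi).
  by apply/both_coordsP; split; apply: (con_leW kd);
    [move: (congr1 (@^~ false) uv)|move: (congr1 (@^~ true) uv)].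
have gP u v : con_image g Psi' (g u) (g v) <-> Psi' u v.
  have -> : con_image g Psi' (g u) (g v) =
    con_preim g (con_image g Psi') u v by [].
  by rewrite con_imageK (join_l kg).
have gd x : g (bdiag bool b' x) = bdiag bool _ (f x) by exact: bpow_ext.
exists (con_image g Psi'); split=> [x y [s [t [<- <- ast]]]|x y h].
  rewrite -!gd; apply/gP => /=.
  have E z : bmap bb (bdiag bool b' z) = bdiag bool _ z by exact: bpow_ext.
  by rewrite !E; apply: Pa; exact: con_leW ast.
have [s sx] := epi_surj f x; have [t ty] := epi_surj f y; subst x y.
have -> : bpair h = g (bpair (h : b' s t)) by apply: bpow_ext => -[].
rewrite -gd => /gP /= P; apply/con_imageP/con_joinl.
apply: (Pd _ _ (bb _ _ h)).
have -> : bpair (bb s t h) = bmap bb (bpair (h : b' s t)).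
  by apply: bpow_ext => -[].
suff -> : bdiag bool (b `|` d)%O s = bmap bb (bdiag bool b' s) by [].
exact: bpow_ext.
Qed.

End CentralityAndQuotients.

Section Commutator.
Variables (S : signature) (V : variety S) (hmod : congruence_modular V).

Definition centrality_commutator : com_op V :=
  fun A a b => con_inf [set d | centralizes a b d].

(** Centralizing moduli form a principal filter, being closed under
    intersections and upwards. *)
Lemma centrality_commutatorP (A : alg V) (a b d : Con A) :
  (centrality_commutator a b <= d) <-> centralizes a b d.
Proof.
split=> [h|h]; last exact: con_inf_lb.
by apply: (central_upward hmod h); exact: central_inf.
Qed.

Lemma centrality_commutator_admissible : admissible centrality_commutator.
Proof.
split=> [A a b|A B f a b]; first exact/centrality_commutatorP/central_meet.
apply/le_anti/andP; split.
  rewrite leUx Ker_le_preim andbT; apply/centrality_commutatorP/central_preim.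
  exact/centrality_commutatorP.
set e := (centrality_commutator a b `|` Ker f)%O.
have <- : con_preim f (con_image f e) = e.
  by rewrite con_imageK (join_l (leUr _ _)).
apply/con_preim_mono/centrality_commutatorP/(central_image hmod); first exact: leUr.
by apply/centrality_commutatorP; exact: leUl.
Qed.

(** Already the admissible operation [centrality_commutator] takes the value
    [\top] here, and the commutator is above it. *)
Lemma commutator_top (hsd : semidegenerate V) (A : alg V) :
  commutator (\top : Con A) (\top : Con A) = \top.
Proof.
apply/le_anti; rewrite lex1 /=.
have [_ /(_ _ centrality_commutator_admissible A \top \top)] :=
  commutator_greatest V.
apply: le_trans; rewrite (central_top hsd (d := centrality_commutator _ _)) //.
exact/centrality_commutatorP.
Qed.

Definition monotone_hull (C : com_op V) : com_op V := fun A a b =>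
  con_sup [set c | exists a' b', [/\ a' <= a, b' <= b & c = C A a' b']].

(** The point is that a congruence [u] below the image of [c] is the image of a
    congruence below [c], namely of [c] intersected with the preimage of [u];
    this is the modular law for the kernel, [c] and the preimage. *)
Lemma monotone_hull_admissible C : admissible C -> admissible (monotone_hull C).
Proof.
move=> [C1 C2]; split=> [A a b|A B f a b].
  apply: con_sup_lub => _ [a' [b' [aa bb ->]]].
  by apply: le_trans (C1 _ _ _) _; exact: leI2.
apply/le_anti/andP; split.
  rewrite leUx Ker_le_preim andbT.
  apply: con_sup_lub => _ [a' [b' [aa bb ->]]].
  apply: le_trans (leUl _ (Ker f)) _; rewrite C2; apply: con_preim_mono.
  apply: con_sup_ub; exists (con_image f a'), (con_image f b'); split=> //.
    by rewrite con_image_le con_imageK; apply: le_trans aa _; exact: leUl.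
  by rewrite con_image_le con_imageK; apply: le_trans bb _; exact: leUl.
have lift (c : Con A) (u : Con B) : u <= con_image f c ->
    exists2 c', c' <= c & con_image f c' = u.
  move=> uc; exists (c `&` con_preim f u)%O; first exact: leIl.
  apply/le_anti; rewrite con_image_le leIr /=.
  rewrite -[u in u <= _](con_preimK f) con_image_le con_imageK.
  rewrite joinC (hmod c (Ker_le_preim f u)).
  by rewrite lexI lexx andbT joinC -con_imageK; exact: con_preim_mono.
set e := (monotone_hull C a b `|` Ker f)%O.
have <- : con_preim f (con_image f e) = e.
  by rewrite con_imageK (join_l (leUr _ _)).
apply: con_preim_mono; apply: con_sup_lub => _ [u [v [ua vb ->]]].
have [a' aa <-] := lift _ _ ua; have [b' bb <-] := lift _ _ vb.
rewrite -[X in X <= _](con_preimK f) con_image_le.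
rewrite -C2 con_imageK; apply: leU2 => //; apply: le_trans (leUl _ _).
by apply: con_sup_ub; exists a', b'.
Qed.

Lemma commutator_mono (A : alg V) (a b c d : Con A) :
  a <= c -> b <= d -> commutator a b <= commutator c d.
Proof.
move=> ac bd; have [ad] := commutator_greatest V.
move=> /(_ _ (monotone_hull_admissible ad) A c d); apply: le_trans.
by apply: con_sup_ub; exists a, b.
Qed.

End Commutator.

(** * Minimal prime ideals of a bounded distributive lattice *)

Section DistributiveLattice.
Variables (disp : Order.disp_t) (L : tbDistrLatticeType disp).
Implicit Types (x y z : L) (G : set L) (P Q : SpecId L).

Definition proper_filter G : Prop :=
  [/\ G \top, forall x y, G x -> G y -> G (x `&` y)%O,
      forall x y, x <= y -> G x -> G y & ~ G \bot].

(** The union of the empty chain is the empty set, which is therefore added to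
    the family; it is not maximal, since [G] is larger. *)
Lemma ultrafilter_exists G : proper_filter G ->
  exists U, [/\ proper_filter U, G `<=` U &
    forall W, proper_filter W -> U `<=` W -> W `<=` U].
Proof.
move=> pG; have [G1 _ _ _] := pG.
pose ok X := X = set0 \/ proper_filter X /\ G `<=` X.
have [F Fok tot|U [[U0|[pU GU]] Umax]] := @Zorn_bigcup _ ok; last 1 first.
- exists U; split=> // W pW UW; apply: contrapT => WU.
  by apply: (Umax W); [split|right; split=> //; exact: subset_trans UW].
- have [[X [FX X0]]|F0] := pselect (exists X, F X /\ X <> set0); last first.
    left; apply/seteqP; split=> // x [X FX Xx]; apply: F0.
    by exists X; split=> // E; rewrite E in Xx.
  have okF Y y : F Y -> Y y -> proper_filter Y /\ G `<=` Y.
    by move=> FY Yy; have [E|//] := Fok _ FY; rewrite E in Yy.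
  have [//|[[X1 _ _ _] GX]] := Fok _ FX.
  right; split=> [|x /GX Xx]; last by exists X.
  split; first by exists X.
  + move=> x y [Y FY Yx] [Z FZ Zy]; have [YZ|ZY] := tot _ _ FY FZ.
      by exists Z => //; have [[_ + _ _] _] := okF _ _ FZ Zy; apply=> //; exact: YZ.
    by exists Y => //; have [[_ + _ _] _] := okF _ _ FY Yx; apply=> //; exact: ZY.
  + move=> x y xy [Y FY Yx]; exists Y => //.
    by have [[_ _ up _] _] := okF _ _ FY Yx; exact: up xy Yx.
  + by move=> [Y FY Y0]; have [[_ _ _ nY0] _] := okF _ _ FY Y0; exact: nY0.
- have [] : ~ ok G by apply: Umax; rewrite U0; split=> // /(_ _ G1).
  by right; split.
Qed.

(** The complement of a maximal proper filter [U] is a minimal prime ideal: an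
    element outside [U] is disjoint from some element of [U], which makes the
    complement closed under joins, and the complement of a smaller prime ideal
    is a proper filter above [U]. *)
Lemma minimal_prime_avoiding G : proper_filter G ->
  exists P, MinId P /\ forall x, G x -> ~ val P x.
Proof.
move=> /ultrafilter_exists[U [[U1 Um Uup U0] GU Umax]].
have notU x : ~ U x -> exists2 u, U u & (x `&` u)%O = \bot.
  move=> Ux; apply: contrapT => h; apply: Ux.
  pose W := [set z | exists2 u, U u & (x `&` u)%O <= z].
  apply: (Umax W); last by exists \top => //; rewrite leIl.
  - split; first by exists \top => //; exact: lex1.
    + move=> s t [u Uu us] [v Uv vt]; exists (u `&` v)%O; first exact: Um.
      rewrite lexI; apply/andP; split.
        by apply: le_trans us; apply: leI2 => //; exact: leIl.
      by apply: le_trans vt; apply: leI2 => //; exact: leIr.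
    + by move=> s t st [u Uu us]; exists u => //; exact: le_trans st.
    + by move=> [u Uu]; rewrite lex0 => /eqP xu; apply: h; exists u.
  - by move=> u Uu; exists u => //; exact: leIr.
have pI : prime_ideal (~` U).
  split; last 1 first.
  - move=> x y Uxy; apply: contrapT => /not_orP[/contrapT Ux /contrapT Uy].
    by apply: Uxy; exact: Um.
  - split=> [//|x y /notU[u Uu xu] /notU[v Uv yv] Uxy|x y xy Uy Ux].
      apply: U0; suff <- : ((x `|` y) `&` (u `&` v))%O = \bot.
        by apply: (Um) => //; exact: (Um).
      by rewrite meetUl meetA xu meet0x join0x [(u `&` v)%O]meetC meetA yv meet0x.
    by apply: Uy; exact: Uup Ux.
  - by move=> E; have : (~` U) \top by rewrite E.
pose P : SpecId L := SigSub (mem_set pI).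
have PE : val P = ~` U by [].
exists P; split=> [Q QP|x Gx]; last by rewrite PE => /(_ (GU _ Gx)).
have [[Q0 QU Qdn] QT Qpr] := SpecIdP Q.
have pQ : proper_filter (~` val Q).
  split=> [Q1|x y Qx Qy /Qpr[]//|x y xy Qx Qy|//]; last by apply: Qx; exact: Qdn Qy.
  by apply: QT; apply/seteqP; split=> // x _; exact: Qdn (lex1 x) Q1.
apply/val_inj; apply/seteqP; split=> // x; rewrite PE => Ux.
apply: contrapT => Qx; apply: Ux; apply: (Umax _ pQ) => //.
by move=> u Uu Qu; have := QP _ Qu; rewrite PE; apply.
Qed.

(** The elements above some [x `&` s] with [s] outside [P] form a filter, proper
    because [P] contains the annihilator of [x]; a minimal prime avoiding it
    omits [x] and every [s] outside [P]. *)
Lemma minimal_prime_below P x : Ann x `<=` val P ->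
  exists Q, [/\ MinId Q, val Q `<=` val P & ~ val Q x].
Proof.
move=> xP; have [[P0 PU Pdn] PT Ppr] := SpecIdP P.
pose G := [set z | exists2 s, ~ val P s & (x `&` s)%O <= z].
have P1 : ~ val P \top.
  by move=> P1; apply: PT; apply/seteqP; split=> // y _; exact: Pdn (lex1 y) P1.
have [|Q [mQ QG]] := @minimal_prime_avoiding G.
  split; first by exists \top => //; exact: lex1.
  - move=> s t [u Pu us] [v Pv vt]; exists (u `&` v)%O; first by case/Ppr.
    rewrite lexI; apply/andP; split.
      by apply: le_trans us; apply: leI2 => //; exact: leIl.
    by apply: le_trans vt; apply: leI2 => //; exact: leIr.
  - by move=> s t st [u Pu us]; exists u => //; exact: le_trans st.
  - by move=> [u Pu]; rewrite lex0 => /eqP xu; apply/Pu/xP.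
exists Q; split=> // [y Qy|]; last by apply: QG; exists \top => //; exact: leIl.
by apply: contrapT => Py; apply: (QG y) => //; exists y => //; exact: leIr.
Qed.

Lemma minimal_prime_ann P x : MinId P -> val P x ->
  exists2 y, (x `&` y)%O = \bot & ~ val P y.
Proof.
move=> mP Px; apply: contrapT => h.
have [|Q [_ /mP -> //]] := @minimal_prime_below P x.
by move=> y xy; apply: contrapT => Py; apply: h; exists y.
Qed.

(** Given a proper filter [F] of sets of minimal primes, the elements [x]
    belonging to [F]-almost all primes form an ideal [J], and a minimal prime is
    a cluster point of [F] as soon as it contains [J].  Such a prime is one that
    avoids the pseudocomplements of the elements of [J]; these generate a proper
    filter because a minimal prime containing [x] omits some element of the
    annihilator of [x]. *)
Lemma pseudocomplemented_MinId_compact :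
  (forall x, exists e, Ann x = principal_ideal e) -> compact [set: MinIdZ L].
Proof.
move=> pc F FF _.
pose J x := F [set P : MinIdZ L | val (val P) x].
have J0 : J \bot.
  apply: filterS filterT => P _ /=.
  by have [[]] := SpecIdP (val P).
pose G z := exists2 x, J x & Ann x `<=` [set y | y <= z].
have JU x y : J x -> J y -> J (x `|` y)%O.
  move=> Jx Jy; apply: filterS (filterI Jx Jy) => P [] /=.
  by have [[_ + _] _ _] := SpecIdP (val P); apply.
have [|P [mP PG]] := @minimal_prime_avoiding G.
  split; first by exists \bot => // y _; exact: lex1.
  - move=> s t [x Jx xs] [y Jy yt]; exists (x `|` y)%O; first exact: JU.
    move=> z; rewrite /Ann /= meetUl => /eqP; rewrite -lex0 leUx !lex0.
    by move=> /andP[/eqP xz /eqP yz]; rewrite lexI xs ?yt.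
  - by move=> s t st [x Jx xs]; exists x => // z /xs /= /le_trans; apply.
  - move=> [x Jx x0]; have /filter_ex[Q /= Qx] := Jx.
    have [y /x0 /=] := minimal_prime_ann (set_valP Q) Qx.
    by rewrite lex0 => /eqP ->; case; have [[]] := SpecIdP (val Q).
have JP x : J x -> val P x.
  move=> Jx; have [e Ee] := pc x.
  have nPe : ~ val P e by apply: PG; exists x => //; rewrite Ee.
  have xe : (x `&` e)%O = \bot.
    by have : Ann x e by rewrite Ee /principal_ideal /=.
  have [[P0 _ _] _ Ppr] := SpecIdP P.
  by have [|//|//] := Ppr x e; rewrite ?xe.
exists (SigSub (mem_set mP)); split=> // X B FX.
rewrite nbhsE => -[U [[W oW <-] /= WP] UB].
have [Z WE] : stone_open W by [].
move: WP; rewrite WE => -[z Zz /= nPz].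
apply: contrapT => XB; apply/nPz/JP; apply: filterS FX => Q XQ /=.
apply: contrapT => nQz; apply: XB; exists Q; split=> //; apply: UB.
by rewrite WE; exists z.
Qed.

Lemma stone_conormal : stone_lattice L -> conormal_lattice L.
Proof.
move=> st a b ab; have [e [f [ef0 ef1]] Ea] := st a.
have bE : b <= e by have : principal_ideal e b by rewrite -Ea.
exists e, f; split=> //.
  by have : Ann a e by rewrite Ea /principal_ideal /=.
by apply/le_anti; rewrite le0x andbT -ef0 leI2.
Qed.

(** The Stone condition at a single element, so that it can be proved for
    principal congruences first and then propagated to finite joins. *)
Definition stone_at x : Prop :=
  exists2 e, complemented e & Ann x = principal_ideal e.

Lemma stone_at_bot : stone_at \bot.
Proof.
exists \top; first by exists \bot; rewrite meetx0 joinx0.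
by apply/seteqP; split=> x _; rewrite /Ann /principal_ideal /= ?lex1 ?meet0x.
Qed.

Lemma stone_at_join x y : stone_at x -> stone_at y -> stone_at (x `|` y)%O.
Proof.
move=> [e [e' [ee0 ee1]] Ex] [f [f' [ff0 ff1]] Ey]; exists (e `&` f)%O.
  exists (e' `|` f')%O; split.
    rewrite meetUr -meetA [(f `&` e')%O]meetC meetA ee0 meet0x join0x.
    by rewrite -meetA ff0 meetx0.
  by rewrite joinIl joinA ee1 join1x meet1x [(e' `|` f')%O]joinC joinA ff1 join1x.
apply/seteqP; split=> z.
  rewrite /Ann /= meetUl => /eqP; rewrite -lex0 leUx !lex0.
  move=> /andP[/eqP xz /eqP yz].
  have ze : principal_ideal e z by rewrite -Ex.
  have zf : principal_ideal f z by rewrite -Ey.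
  by rewrite /principal_ideal /= lexI ze zf.
rewrite /principal_ideal /= lexI => /andP[ze zf].
have xz : Ann x z by rewrite Ex.
have yz : Ann y z by rewrite Ey.
by rewrite /Ann /= meetUl xz yz joinx0.
Qed.

End DistributiveLattice.

(** * Compact congruences and prime congruences *)

Section CompactCongruences.
Variables (S : signature) (A : algebra S).
Implicit Types (a b c : Con A) (X : set (Con A)).

(** Compactness in the form used below: in a directed family the finite
    subfamily of the definition is dominated by a single member. *)
Lemma con_sup_directed X b : X !=set0 ->
  (forall c d, X c -> X d -> exists e, [/\ X e, c <= e & d <= e]) ->
  K b -> b <= con_sup X -> exists2 c, X c & b <= c.
Proof.
move=> [c0 Xc0] dir Kb /Kb[Y [/finite_seqP[s ->] sX bs]].
suff [c Xc sc] : exists2 c, X c & con_sup [set` s] <= c.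
  by exists c => //; exact: le_trans sc.
elim: s sX {bs} => [|d s IH] sX; first by exists c0 => //; exact: con_sup_lub.
have [|c Xc sc] := IH; first by move=> e es; apply: sX; rewrite /= inE es orbT.
have [|e [Xe ce de]] := dir c d Xc; first by apply: sX; rewrite /= inE eqxx.
exists e => //; apply: con_sup_lub => r /=; rewrite inE => /orP[/eqP -> //|rs].
by apply: le_trans ce; apply: le_trans sc; exact: con_sup_ub.
Qed.

Lemma Cg_compact x y : K (Cg x y : Con A).
Proof.
by move=> X /Cg_le/con_sup_fin[Y [fY YX h]]; exists Y; split=> //; apply/Cg_le.
Qed.

Lemma compact_leP a b : (forall c, K c -> c <= a -> c <= b) -> a <= b.
Proof.
move=> h; apply/con_leP => x y /Cg_le xy.
by apply/Cg_le/h => //; exact: Cg_compact.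
Qed.

Lemma compact_principal a : K a -> exists s : seq (Con A),
  (forall c, c \in s -> PCon c) /\ a = con_sup [set` s].
Proof.
move=> Ka.
have [|Y [/finite_seqP[s ->] sX as_]] := Ka [set c | PCon c /\ c <= a].
  apply/con_leP => x y /Cg_le xy; apply/Cg_le/con_sup_ub.
  by split=> //; exists x, y.
exists s; split=> [c /sX[]//|]; apply/le_anti; rewrite as_ /=.
by apply: con_sup_lub => c /sX[].
Qed.

End CompactCongruences.

Section Primes.
Variables (S : signature) (V : variety S).
Variables (hmod : congruence_modular V) (hsd : semidegenerate V).
Variable A : alg V.
Implicit Types (a b c : Con A) (p q : Spec A).

(** Zorn's lemma; the join of a chain of proper congruences is proper because
    [\top] is compact. *)
Lemma maximal_exists a : a <> \top -> exists m : Con A,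
  [/\ a <= m, m <> \top & forall c, m <= c -> c <> \top -> c = m].
Proof.
move=> aT; pose T := {c : Con A | a <= c /\ c <> \top}.
pose R (c d : T) : bool := sval c <= sval d.
have [||||[m [am mT]] max] := @Zorn T R.
- by move=> c; exact: lexx.
- by move=> c d e; exact: le_trans.
- move=> [c hc] [d hd] cd dc; have E : c = d by apply/le_anti/andP.
  by subst d; congr exist; exact: Prop_irrelevance.
- move=> F tot; pose X := [set c | exists2 t, F t & c = sval t].
  have [[t Ft]|F0] := pselect (exists t, F t); last first.
    by exists (exist _ a (conj (lexx a) aT)) => t Ft; case: F0; exists t.
  have sT : con_sup X <> \top.
    move=> E; have [||||c [u _ ->]] := @con_sup_directed _ A X \top.
    + by exists (sval t), t.
    + move=> _ _ [u Fu ->] [v Fv ->].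
      by case: (tot u v Fu Fv) => uv; [exists (sval v)|exists (sval u)];
        split=> //; [exists v|exists u].
    + exact: K_top.
    + by rewrite E.
    + by have [_ uT] := svalP u => uT'; apply: uT; apply/le_anti; rewrite lex1.
  have as_ : a <= con_sup X.
    apply: le_trans (con_sup_ub _); last by exists t.
    by case: (svalP t).
  exists (exist _ (con_sup X) (conj as_ sT)) => u Fu.
  by apply: con_sup_ub; exists u.
exists m; split=> // c mc cT.
have /(congr1 (@sval _ _)) // := max (exist _ c (conj (le_trans am mc) cT)) mc.
Qed.

(** Two congruences not below [m] have image [\top] in the quotient by [m], so
    their commutator also has image [\top] and cannot be below [m]. *)
Lemma maximal_prime (m : Con A) : m <> \top ->
  (forall c, m <= c -> c <> \top -> c = m) -> prime_con m.
Proof.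
move=> mT max; split=> // a b abm.
have full c : ~ c <= m -> (c `|` m)%O = \top.
  move=> cm; apply: contrapT => /max E; apply: cm.
  by rewrite -E ?leUl ?leUr.
apply: contrapT => /not_orP[/full aT /full bT].
have piP : forall (f : symbol S) (x : 'I_(arity f) -> A),
    quo_pi m (opr x) = @opr S (quo m) f (fun i => quo_pi m (x i)).
  by move=> f x; exact: quo_pi_opr.
have pis (X : quo m) : exists x, quo_pi m x = X.
  by exists (quo_repr X); exact: quo_reprK.
pose f := @Epi S A (quo m) (quo_pi m) piP pis.
have kf : Ker f = m by apply: con_ext => x y; exact: quo_piP.
have top c : (c `|` m)%O = \top -> con_image f c = \top.
  move=> cT; apply/le_anti; rewrite lex1 /=; apply/con_leP => u v _.
  have [x <-] := epi_surj f u; have [y <-] := epi_surj f v.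
  by apply: (proj2 (@con_imageP S V A (quo m) f c x y)); rewrite kf cT.
have [[_ /(_ A (quo m) f a b) E] _] := commutator_greatest V.
move: E; rewrite (top a) ?(top b) // commutator_top // kf (join_r abm) => E.
by apply: mT; rewrite E; apply: con_ext.
Qed.

Lemma proper_below_prime a : a <> \top -> exists p, a <= val p.
Proof.
move=> /maximal_exists[m [am mT max]].
by exists (SigSub (mem_set (maximal_prime mT max))).
Qed.

End Primes.

(** * Prime congruences and prime ideals of the reticulation *)

Section ReticulationSpectrum.
Variables (S : signature) (V : variety S).
Variables (hmod : congruence_modular V) (hsd : semidegenerate V).
Variables (A : alg V) (hK : K_comm_closed A).
Local Notation L := (reticulation hsd hK).
Local Notation lam := (@lambda S V A hsd hK).
Implicit Types (a b c : Con A) (p q : Spec A) (P Q : SpecId L) (k l : Kcon A).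

Lemma lambda_le k l : (lam k <= lam l) <-> specD (val k) `<=` specD (val l).
Proof.
rewrite leEmeet lambda_meet; split=> [/eqP/lambdaE/rhoE|kl].
  by rewrite /= specD_comm => /setIidPl.
by apply/eqP/lambdaE/rhoE; rewrite /= specD_comm; exact/setIidPl.
Qed.

Lemma lambda_eq1 k : lam k = \top <-> specD (val k) = setT.
Proof.
rewrite -lambda_top; split=> [/lambdaE/rhoE ->|E]; first exact: specD_top.
by apply/lambdaE/rhoE; rewrite E specD_top.
Qed.

Lemma lambda_eq0 k : lam k = \bot <-> specD (val k) = set0.
Proof.
rewrite -lambda_bot; split=> [/lambdaE/rhoE ->|E]; first exact: specD_bot.
by apply/lambdaE/rhoE; rewrite E specD_bot.
Qed.

Lemma lambda_meet0 k l :
  (lam k `&` lam l)%O = \bot <-> specD (val k) `&` specD (val l) = set0.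
Proof. by rewrite lambda_meet lambda_eq0 /= specD_comm. Qed.

Lemma lambda_join1 k l :
  (lam k `|` lam l)%O = \top <-> specD (val k) `|` specD (val l) = setT.
Proof. by rewrite lambda_join lambda_eq1 /= specD_join. Qed.

Definition con_of_ideal (I : set L) : Con A :=
  con_sup [set a | exists2 k, val k = a & I (lam k)].

(** For compact congruences membership in the ideal is recovered, because the
    join defining [con_of_ideal] is directed. *)
Lemma con_of_idealP (I : set L) k : lattice_ideal I ->
  (val k <= con_of_ideal I) <-> I (lam k).
Proof.
move=> [I0 IU Idn]; split=> [kI|Ik]; last by apply: con_sup_ub; exists k.
have [|||_ [l <- Il] kl] := con_sup_directed _ _ _ kI.
- by exists \bot, (Kbot A); rewrite ?lambda_bot.
- move=> _ _ [l <- Il] [l' <- Il']; exists (val (Kjoin l l')).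
  split; [|exact: leUl|exact: leUr].
  by exists (Kjoin l l') => //; rewrite -lambda_join; exact: IU.
- exact: KconP.
apply: Idn Il; apply/lambda_le => p; rewrite /specD /=.
by apply: contra => /=; exact: le_trans.
Qed.

(** Monotonicity of the commutator reduces primality to compact congruences,
    where it is primality of the ideal. *)
Lemma con_of_ideal_prime P : prime_con (con_of_ideal (val P)).
Proof.
have [idP PT Ppr] := SpecIdP P; have [_ _ Pdn] := idP; split=> [E|a b ab].
  apply: PT; apply/seteqP; split=> // x _; apply: Pdn (lex1 x) _.
  by rewrite -lambda_top; apply/con_of_idealP => //; rewrite E lex1.
apply: contrapT => /not_orP[aP bP].
have out c : ~ c <= con_of_ideal (val P) ->
    exists2 k, val k <= c & ~ val P (lam k).
  move=> cP; apply: contrapT => h; apply: cP; apply: compact_leP => d Kd dc.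
  have -> : d = val (mkK Kd) by [].
  apply/con_of_idealP => //; apply: contrapT => dP.
  by apply: h; exists (mkK Kd).
have [k ka Pk] := out _ aP; have [l lb Pl] := out _ bP.
have [|//|//] := Ppr (lam k) (lam l).
rewrite lambda_meet; apply/con_of_idealP => //=.
by apply: le_trans ab; exact: commutator_mono.
Qed.

Definition spec_of_ideal P : Spec A := SigSub (mem_set (con_of_ideal_prime P)).

Definition ideal_of_con (c : Con A) : set L := [set x | val (lambda_repr x) <= c].

Lemma ideal_of_conP p k : ideal_of_con (val p) (lam k) <-> val k <= val p.
Proof.
have /lambdaE/rhoE E : lam (lambda_repr (lam k)) = lam k by exact: lambda_surj.
have := congr1 (@^~ p) E; rewrite /specD /mkset /ideal_of_con /= => {}E.
by split=> [h|h]; apply: contrapT => /negP; [rewrite -E h|rewrite E h].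
Qed.

Lemma ideal_of_con_prime p : prime_ideal (ideal_of_con (val p)).
Proof.
have pp := SpecP p; split=> [|E|x y].
- split=> [|x y|x y].
  + by rewrite -lambda_bot; apply/ideal_of_conP; exact: le0x.
  + rewrite -(lambda_surj x) -(lambda_surj y) lambda_join => /ideal_of_conP h.
    by move=> /ideal_of_conP h'; apply/ideal_of_conP; rewrite /= leUx h.
  + rewrite -(lambda_surj x) -(lambda_surj y) => /lambda_le h /ideal_of_conP yp.
    apply/ideal_of_conP; apply: contrapT => /negP /(h p).
    by rewrite /specD /= yp.
- have : ideal_of_con (val p) \top by rewrite E.
  rewrite -lambda_top => /ideal_of_conP /= h.
  by case: pp => pT _; apply: pT; apply/le_anti; rewrite lex1.
- rewrite -(lambda_surj x) -(lambda_surj y) lambda_meet => /ideal_of_conP /=.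
  by rewrite prime_commE // => /orP[]h; [left|right]; apply/ideal_of_conP.
Qed.

Definition ideal_of_spec p : SpecId L := SigSub (mem_set (ideal_of_con_prime p)).

Lemma ideal_of_specK p : spec_of_ideal (ideal_of_spec p) = p.
Proof.
apply/val_inj/le_anti/andP; split; apply: compact_leP => c Kc;
  have -> : c = val (mkK Kc) by [].
  move=> /con_of_idealP h; apply/ideal_of_conP; apply: h.
  by case: (ideal_of_con_prime p).
move=> cp; apply/con_of_idealP; first by case: (ideal_of_con_prime p).
exact/ideal_of_conP.
Qed.

Lemma spec_of_idealK P : ideal_of_spec (spec_of_ideal P) = P.
Proof.
have [idP _ _] := SpecIdP P.
apply/val_inj/seteqP; split=> x; rewrite -(lambda_surj x).
  by move=> /(ideal_of_conP (spec_of_ideal P)) /con_of_idealP; apply.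
by move=> Px; apply/(ideal_of_conP (spec_of_ideal P))/con_of_idealP.
Qed.

Lemma ideal_of_spec_le p q :
  (val (ideal_of_spec p) `<=` val (ideal_of_spec q)) <-> (val p <= val q).
Proof.
split=> [pq|pq x].
  apply: compact_leP => c Kc cp.
  by apply/(ideal_of_conP q (mkK Kc))/pq/ideal_of_conP.
by move=> xp; exact: le_trans pq.
Qed.

Lemma ideal_of_spec_min p : MinId (ideal_of_spec p) <-> Min p.
Proof.
split=> [mp q qp|mp Q].
  rewrite -(ideal_of_specK q) (mp (ideal_of_spec q)) ?ideal_of_specK //.
  exact/ideal_of_spec_le.
rewrite -(spec_of_idealK Q) => /ideal_of_spec_le h.
by rewrite (mp _ h).
Qed.

Lemma spec_of_ideal_min P : MinId P -> Min (spec_of_ideal P).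
Proof. by move=> mP; apply/ideal_of_spec_min; rewrite spec_of_idealK. Qed.

Definition min_of_ideal (P : MinIdZ L) : MinZ A :=
  SigSub (mem_set (spec_of_ideal_min (set_valP P))).

(** The correspondence with prime ideals restricts to a continuous surjection:
    the preimage of [specD c] is the union of the basic open sets of the compact
    congruences below [c]. *)
Lemma MinZ_compact : compact [set: MinIdZ L] -> compact [set: MinZ A].
Proof.
move=> cL; suff <- : min_of_ideal @` [set: MinIdZ L] = [set: MinZ A].
  apply: continuous_compact => //; apply: continuous_subspaceT.
  apply: continuous_comp_initial.
  apply/continuousP => U [c ->].
  exists (\bigcup_(x in [set lam k | k in [set k | val k <= c]]) idealD x).
    by exists [set lam k | k in [set k | val k <= c]].
  apply/seteqP; split=> P /=.
    move=> [_ [k /= kc <-] Pk]; rewrite /specD /=.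
    apply/negP => cP; apply: Pk.
    have [idP _ _] := SpecIdP (val P).
    by apply/con_of_idealP => //; exact: le_trans cP.
  move=> /negP cP; apply: contrapT => h; apply: cP.
  apply: compact_leP => d Kd dc; apply: contrapT => dP; apply: h.
  exists (lam (mkK Kd)); first by exists (mkK Kd).
  move=> Pd; apply: dP; have [idP _ _] := SpecIdP (val P).
  by apply/(con_of_idealP (mkK Kd) idP).
apply/seteqP; split=> // p _.
have mp := proj2 (ideal_of_spec_min (val p)) (set_valP p).
exists (SigSub (mem_set mp)) => //; apply/val_inj; exact: ideal_of_specK.
Qed.

End ReticulationSpectrum.

(** * Semiprime algebras *)

Section SemiprimeAlgebra.
Variables (S : signature) (V : variety S).
Variables (hmod : congruence_modular V) (hsd : semidegenerate V).
Variables (A : alg V) (hsp : semiprime A) (hK : K_comm_closed A).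
Local Notation L := (reticulation hsd hK).
Local Notation lam := (@lambda S V A hsd hK).
Implicit Types (a b c : Con A) (p q : Spec A) (k l : Kcon A).

Lemma specD_eq0 a : specD a = set0 -> a = \bot.
Proof.
move=> a0; apply/le_anti; rewrite le0x andbT -hsp; apply: con_inf_glb => p [pp _].
apply: contrapT => /negP ap.
by have : specD a (SigSub (mem_set pp)) by []; rewrite a0.
Qed.

(** Semiprimeness makes [\bot] the intersection of all primes, so a commutator
    vanishes as soon as it lies in every prime. *)
Lemma comm_eq0 a b : commutator a b = \bot <-> specD a `&` specD b = set0.
Proof.
rewrite -specD_comm; split=> [->|]; first exact: specD_bot.
exact: specD_eq0.
Qed.

Lemma specD_perp a : specD a `&` specD (perp a) = set0.
Proof.
rewrite /perp specD_sup setI_bigcupr -subset0 => p [c /comm_eq0 <-].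
by [].
Qed.

Lemma specD_mono a b : a <= b -> specD a `<=` specD b.
Proof. by move=> ab p; rewrite /specD /=; apply: contra => /=; exact: le_trans. Qed.

Lemma perpP a b : b <= perp a <-> specD a `&` specD b = set0.
Proof.
split=> [ba|/comm_eq0]; last by move=> ?; apply: con_sup_ub.
by rewrite -subset0 -(specD_perp a); apply: setIS; exact: specD_mono.
Qed.

(** [minimal_prime_below] carried over to congruences: the annihilator of [lam k]
    lies in the prime ideal of [p] because [perp k] lies in [p]. *)
Lemma minimal_below_avoiding p k : perp (val k) <= val p ->
  exists q, [/\ Min q, val q <= val p & ~ val k <= val q].
Proof.
move=> kp.
have [x|Q [mQ Qp nQ]] :=
  @minimal_prime_below _ L (ideal_of_spec hsd hK p) (lam k).
  rewrite -(lambda_surj x) /Ann /= lambda_meet0 => /perpP xk.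
  by apply/ideal_of_conP; exact: le_trans kp.
exists (spec_of_ideal hmod Q); split; first exact: spec_of_ideal_min.
  by apply/(ideal_of_spec_le hsd hK); rewrite spec_of_idealK.
by move=> /con_of_idealP; case: (SpecIdP Q) => i _ _ /(_ i).
Qed.

Lemma minimal_below p : exists2 q, Min q & val q <= val p.
Proof.
(* No prime omits [perp \top], since every prime omits [\top]. *)
have [|q [mq qp _]] := @minimal_below_avoiding p (Ktop A hsd); last by exists q.
apply: contrapT => /negP h.
suff : (specD \top `&` specD (perp (\top : Con A))) p by rewrite specD_perp.
by rewrite specD_top; split.
Qed.

(** A prime containing [perp k] has below it a minimal prime that omits [k];
    minimality leaves only the prime itself. *)
Lemma minimal_perp p k : Min p -> perp (val k) <= val p -> ~ val k <= val p.
Proof. by move=> mp /minimal_below_avoiding[q [_ /mp <-]]. Qed.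

(** Compactness of [\top] yields compact [c <= a] and [d <= b] with join
    [\top]; since [specD a] and [specD b] are disjoint, passing from [a] to [c]
    loses no point of the spectrum. *)
Lemma clopen_complemented a b :
  (a `|` b)%O = \top -> specD a `&` specD b = set0 ->
  exists2 k : Kcon A, specD (val k) = specD a & complemented (lam k).
Proof.
move=> abT ab0.
pose X := [set e | exists c d, [/\ K c, K d, c <= a, d <= b & e = (c `|` d)%O]].
have K0 := @K_bot _ A.
have [||||_ [c [d [Kc Kd ca db ->]]] cdT] := @con_sup_directed _ A X \top.
- by exists (\bot `|` \bot)%O, \bot, \bot; split=> //; exact: le0x.
- move=> _ _ [c [d [Kc Kd ca db ->]]] [c' [d' [Kc' Kd' ca' db' ->]]].
  exists ((c `|` c') `|` (d `|` d'))%O; split.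
  + by exists (c `|` c')%O, (d `|` d')%O; split=> //; rewrite ?leUx ?ca ?db //;
      exact: K_join.
  + by apply: leU2; exact: leUl.
  + by apply: leU2; exact: leUr.
- exact: K_top.
- rewrite -abT leUx; apply/andP; split; apply: compact_leP => c Kc cx;
    apply: con_sup_ub.
    by exists c, \bot; split=> //; rewrite ?le0x ?joinx0.
  by exists \bot, c; split=> //; rewrite ?le0x ?join0x.
have {}cdT : specD c `|` specD d = setT.
  by rewrite -specD_join -specD_top; congr specD; apply/le_anti; rewrite lex1.
have [sc sd] := (specD_mono ca, specD_mono db).
have ac : specD a `<=` specD c.
  move=> p ap; have : (specD c `|` specD d) p by rewrite cdT.
  by case=> // /sd bp; have : (specD a `&` specD b) p by []; rewrite ab0.
exists (mkK Kc); first exact/seteqP.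
exists (lam (mkK Kd)); split; last exact/lambda_join1.
apply/lambda_meet0; rewrite /= -subset0 -ab0; exact: setISS.
Qed.

Lemma stone_at_lambda k : complemented (perp (val k)) -> stone_at (lam k).
Proof.
move=> [b [pb0 pbT]].
have pb : specD (perp (val k)) `&` specD b = set0.
  by rewrite -specD_comm -specD_bot; congr specD; apply/le_anti;
    rewrite le0x -pb0 comm_leI.
have [l El cl] := clopen_complemented pbT pb.
exists (lam l) => //; apply/seteqP; split=> x; rewrite -(lambda_surj x).
  rewrite /Ann /principal_ideal /= => /lambda_meet0/perpP h.
  by apply/lambda_le; rewrite El; exact: specD_mono.
rewrite /Ann /principal_ideal /= => /lambda_le; rewrite El => h.
apply/lambda_meet0; rewrite -subset0 -(specD_perp (val k)); exact: setIS.
Qed.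

Lemma PP_stone : PP_algebra A -> stone_lattice L.
Proof.
move=> pp x; rewrite -(lambda_surj x); move: (lambda_repr x) => k {x}.
have Kk : K (val k) by exact: KconP.
have [s [sP Ek]] := compact_principal Kk.
suff [l El stl] : exists2 l, val l = con_sup [set` s] & stone_at (lam l).
  by have -> : k = l by apply/val_inj; rewrite El.
elim: s sP {Ek} => [|c s IH] sP.
  exists (Kbot A); last by rewrite lambda_bot; exact: stone_at_bot.
  by apply/le_anti; rewrite le0x /=; apply: con_sup_lub => b.
have [|l El stl] := IH; first by move=> d ds; apply: sP; rewrite inE ds orbT.
have Pc : PCon c by apply: sP; rewrite inE eqxx.
have Kc : K c by case: Pc => x [y ->]; exact: Cg_compact.
exists (Kjoin (mkK Kc) l).
  rewrite /= El; apply/le_anti; rewrite leUx; apply/andP; split.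
    apply/andP; split; first by apply: con_sup_ub; rewrite /= inE eqxx.
    by apply: con_supS => d /= ds; rewrite inE ds orbT.
  apply: con_sup_lub => d /=; rewrite inE => /orP[/eqP ->|ds]; first exact: leUl.
  by apply: le_trans (leUr _ _); exact: con_sup_ub.
by rewrite -lambda_join; apply: stone_at_join stl; exact/stone_at_lambda/pp.
Qed.

(** A minimal prime containing [k] does not contain [perp k], hence misses a
    compact congruence below it. *)
Lemma minimal_witness p k : Min p -> val k <= val p ->
  exists2 l : Kcon A, specD (val k) `&` specD (val l) = set0 & ~ val l <= val p.
Proof.
move=> mp kp; apply: contrapT => h; apply: (minimal_perp mp _ kp).
apply: con_sup_lub => c /comm_eq0 kc; apply: compact_leP => d Kd dc.
apply: contrapT => dp; apply: h; exists (mkK Kd) => //=.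
by rewrite -subset0 -kc; apply: setIS; exact: specD_mono.
Qed.

(** Given distinct minimal primes [q] and [q'] below [p], take [c] in [q'] and
    not in [q], and [l] disjoint from [c] and not in [q'].  Conormality produces
    [i] disjoint from [c] and [j] disjoint from [l] that cover the spectrum;
    but [i] lies in [q] and [j] in [q'], hence both lie in [p]. *)
Lemma conormal_mp : conormal_lattice L -> mp_algebra A.
Proof.
move=> cn p; have [q mq qp] := minimal_below p; exists q; split=> // q' [mq' qp'].
apply: esym; apply: mq => /=; apply: compact_leP => c Kc cq'.
have [l kl nl] := minimal_witness mq' (cq' : val (mkK Kc) <= val q').
apply: contrapT => cq.
have [x [y [cx ly xy]]] := cn _ _ (proj2 (lambda_meet0 hsd hK (mkK Kc) l) kl).
move: cx ly xy; rewrite -(lambda_surj x) -(lambda_surj y).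
move: (lambda_repr x) (lambda_repr y) => i j.
move=> /lambda_meet0 ci /lambda_meet0 lj /lambda_join1 ij.
have below a (r : Spec A) (b : Con A) : specD a `&` specD b = set0 ->
    ~ a <= val r -> b <= val r.
  move=> ab ar; apply: contrapT => /negP br.
  suff : (specD a `&` specD b) r by rewrite ab.
  by split=> //; exact/negP.
have : (specD (val i) `|` specD (val j)) p by rewrite ij.
case; move=> /negP; apply.
  by apply: le_trans qp; exact: below ci cq.
by apply: le_trans qp'; exact: below lj nl.
Qed.

(** A prime above [perp (Cg x y)] and [perp c] would have below it a minimal
    prime omitting [Cg x y] and one omitting [c].  By uniqueness these agree,
    while no prime omits both. *)
Lemma mp_PF : mp_algebra A -> PF_algebra A.
Proof.
move=> mp _ [x [y ->]] c Kc cx; have Kx := @Cg_compact _ A x y.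
apply: contrapT => /(proper_below_prime hmod hsd)[p].
rewrite leUx => /andP[xp cp].
have [q [mq qp xq]] := minimal_below_avoiding (k := mkK Kx) xp.
have [q' [mq' qp' cq']] := minimal_below_avoiding (k := mkK Kc) cp.
have [r [_ rP]] := mp p.
have E : q = q' by rewrite -(rP q) // -(rP q').
subst q'; have /perpP xc := cx.
suff : (specD (Cg x y) `&` specD c) q by rewrite xc.
by split; exact/negP.
Qed.

(** If every compact [l] below [perp k] failed, the sets of minimal primes
    containing both [k] and [l] would generate a proper filter.  These sets are
    closed, so a cluster point is a minimal prime containing [k] and [perp k],
    contrary to [minimal_perp]. *)
Lemma minimal_cover k : compact [set: MinZ A] ->
  exists2 l : Kcon A, val l <= perp (val k) &
    forall p, Min p -> ~ (val k <= val p /\ val l <= val p).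
Proof.
move=> cM; apply: contrapT => h.
pose I : set (Kcon A) := [set l | val l <= perp (val k)].
pose X l : set (MinZ A) := [set p | val k <= val (val p) /\ val l <= val (val p)].
have PF : ProperFilter (filter_from I X).
  apply: filter_from_proper.
    apply: filter_from_filter; first by exists (Kbot A); exact: le0x.
    move=> l l' il il'; exists (Kjoin l l').
      by rewrite /I /= leUx il.
    by move=> p [kp]; rewrite /= leUx => /andP[].
  move=> l il; apply: contrapT => X0; apply: h; exists l => // p mp [kp lp].
  by apply: X0; exists (SigSub (mem_set mp)).
have [|p [_ cl]] := cM _ PF; first by exists (Kbot A) => //; exact: le0x.
have closed a l : I l ->
    (forall q : MinZ A, X l q -> a <= val (val q)) -> a <= val (val p).
  move=> il Xa; apply: contrapT => ap.
  have [||q [Xq /negP nq]] := cl (X l) [set q : MinZ A | ~~ (a <= val (val q))].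
  - by exists l.
  - apply: open_nbhs_nbhs; split; last exact/negP.
    by exists (specD a) => //; exists a.
  - by apply: nq; exact: Xa.
apply: (minimal_perp (k := k) (set_valP p)).
  apply: compact_leP => c Kc cp.
  by apply: (closed _ (mkK Kc)) => // q [].
apply: (closed _ (Kbot A)); first exact: le0x.
by move=> q [].
Qed.

(** With [l] as in [minimal_cover], a minimal prime omits [a] or [l] and so
    contains [perp a] or [perp l]; hence [perp a] and [perp l] intersect in
    [\bot].  Their join is [\top] by purity, as [l <= perp a]. *)
Lemma PF_PP : PF_algebra A -> compact [set: MinZ A] -> PP_algebra A.
Proof.
move=> pf cM a Pa; have Ka : K a by case: Pa => x [y ->]; exact: Cg_compact.
have [l la cov] := minimal_cover (mkK Ka) cM.
exists (perp (val l)); split; last by apply: (pf _ Pa); [exact: KconP|].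
apply: specD_eq0; rewrite -subset0 => p.
have [q mq qp] := minimal_below p.
have red b : ~ b <= val q -> perp b <= val q.
  move=> bq; apply: contrapT => /negP pq.
  have : (specD b `&` specD (perp b)) q by split=> //; exact/negP.
  by rewrite specD_perp.
rewrite /specD /= => /negP; apply; apply: le_trans qp.
have [aq|aq] := pselect (a <= val q); last first.
  by apply: le_trans (leIl _ _) _; exact: red.
apply: le_trans (leIr _ _) _; apply: red => lq.
by apply: (cov q mq).
Qed.

End SemiprimeAlgebra.

Theorem theorem11p9 (S : signature) (V : variety S)
    (hmod : congruence_modular V) (hsd : semidegenerate V)
    (A : alg V) (hsp : semiprime A) (hK : K_comm_closed A) :
  [<-> PP_algebra A;
       stone_lattice (reticulation hsd hK);
       conormal_lattice (reticulation hsd hK) /\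
         compact [set: MinIdZ (reticulation hsd hK)];
       mp_algebra A /\ compact [set: MinZ A];
       PF_algebra A /\ compact [set: MinZ A]].
Proof.
tfae.
- exact: PP_stone.
- move=> st; split; first exact: stone_conormal.
  apply: pseudocomplemented_MinId_compact => x.
  by have [e _ ->] := st x; exists e.
- by move=> [cn cM]; split; [exact: conormal_mp cn|exact: MinZ_compact cM].
- by move=> [mp cM]; split=> //; exact: mp_PF.
- by move=> [pf cM]; exact: PF_PP.
Qed.
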